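(* For $d\ge2$, let $\pi_{d,q}=\dfrac{c_{d,q}}{c_d}$ ($q=0,1,2,\dots$), where $c_{d,q}$ is the number of combinatorial classes of real dimension $q$ in $\Xi_d$ and $c_d=\sum_q c_{d,q}$ is the total number of combinatorial classes in $\Xi_d$. Then $(\pi_{d,q})_{q\ge 0}$ is a discrete probability distribution whose mean $\mu_d$ and variance $\sigma_d^2$ satisfy, as $d\to\infty$, $$\mu_d\sim\kappa d,\qquad \sigma_d^2\sim\lambda d,$$ for some algebraic numbers $\kappa$ and $\lambda$. Moreover, the distributions are asymptotically normal as $d\to\infty$: if $X_d$ is a random variable with $\mathbb{P}(X_d=q)=\pi_{d,q}$, then $(X_d-\mu_d)/\sigma_d$ converges in distribution to the standard normal law.
   Context: Let $d\ge 2$. $\Xi_d\simeq\mathbb{C}^{d-1}$ is the space of vector fields $\xi_P=P(z)\frac{d}{dz}$ on $\mathbb{C}$ with $P(z)=z^d+a_{d-2}z^{d-2}+\dots+a_0$ a monic centered complex polynomial; trajectories are solutions of $\dot z=P(z)$ in real time. Separatrices. The point $\infty$ is a pole of order $d-2$ of $\xi_P$, and there are $2d-2$ trajectory directions at $\infty$, with asymptotic angles $\frac{2\pi\ell}{2d-2}$, $\ell\in\mathbb{Z}/(2d-2)$; those with $\ell$ even are incoming to $\infty$, those with $\ell$ odd are outgoing from $\infty$. The separatrix $s_\ell$ is the maximal trajectory with asymptotic direction $\ell$ at $\infty$. Every separatrix is either landing (its other end tends to an equilibrium point) or homoclinic (it joins $\infty$ to $\infty$); a homoclinic separatrix is written $s_{k,j}$,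 where $k$ odd and $j$ even are its two asymptotic directions. The end $e_\ell$ is $\infty$ with access between $s_{\ell-1}$ and $s_\ell$. The zones of $\xi_P$ are the connected components of $\mathbb{C}$ minus the closure of the union of all separatrices; an $\alpha\omega$-zone is a zone all of whose trajectories have the same $\alpha$-limit equilibrium point and the same $\omega$-limit equilibrium point, these two points being distinct. Each $\alpha\omega$-zone has on its boundary exactly one odd end $e_k$ and exactly one even end $e_j$ such that $s_k$ and $s_j$ are landing; the distinguished transversal $T_{k,j}$ of the zone joins these two ends. Combinatorial data. A combinatorial data set $(\iota,H,T)$ of degree $d$ consists of an involution $\iota$ of $\mathbb{Z}/(2d-2)$ and disjoint subsets $H,T\subset\mathbb{Z}/(2d-2)$ with $H\cup T=\{\ell:\iota(\ell)\neq\ell\}$ such that: (i) if $\iota(\ell)\ne\ell$ then $\ell$ and $\iota(\ell)$ have different parity; (ii) $\iota$ is non-crossing, i.e. the pairs $\{\ell,\iota(\ell)\}$ with $\iota(\ell)\ne \ell$ are pairwise non-crossing when $\mathbb{Z}/(2d-2)$ is placed in cyclic order on a circle; (iii) if $\iota(\ell)\neq\ell$, then $\ell,\iota(\ell)$ are both in $H$ or both in $T$. The data set of $\xi_P$ has as pairs in $H$ the $\{k,j\}$ for the homoclinic separatrices $s_{k,j}$, as pairs in $T$ the $\{k,j\}$ for the distinguished transversals $T_{k,j}$, and all other indices fixed by $\iota$. A combinatorial class in $\Xi_d$ is the set of all vector fields in $\Xi_d$ with a given combinatorial data set. It is known that every combinatorial data set of degree $d$ is realized by some $\xi_P\in\Xi_d$,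 and that each combinatorial class is a connected manifold in $\Xi_d$ of real dimension $q=2s+h$, where $h$ is the number of homoclinic separatrices (pairs in $H$) and $s$ is the number of $\alpha\omega$-zones (pairs in $T$). So $c_{d,q}$ is the number of combinatorial data sets of degree $d$ with $2s+h=q$, and $c_d$ is the number of all combinatorial data sets of degree $d$. The notation $a_d\sim b_d$ means $a_d/b_d\to1$ as $d\to\infty$. *)

(* Defs.v *)
From mathcomp Require Import all_boot all_order all_algebra.
From mathcomp Require Import all_classical all_reals all_analysis.
Set Implicit Arguments.
Unset Strict Implicit.
Unset Printing Implicit Defensive.
Import Order.TTheory GRing.Theory Num.Theory.
Import numFieldNormedType.Exports.

(* Z/(2d-2) is represented by its residues 0, ..., 2d-3: only the parity and
   the cyclic order of the indices are used, not the ring structure. *)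
Definition idx (d : nat) := 'I_(2 * d - 2).

(* Two chords {a, iota a} and {b, iota b} cross iff exactly one of b, iota b
   lies strictly between a and iota a, a condition independent of where the
   circle is cut; up to renaming the endpoints it reads
   a < b < iota a < iota b for the residues. *)
Definition noncrossing (d : nat) (iota : {ffun idx d -> idx d}) : bool :=
  [forall a : idx d, forall b : idx d,
     ~~ [&& a < b, b < iota a & iota a < iota b]].

Definition is_comb_data (d : nat) (iota : {ffun idx d -> idx d})
    (H T : {set idx d}) : bool :=
  [&& [forall l : idx d, iota (iota l) == l],
      [disjoint H & T],
      (H :|: T)%SET == [set l : idx d | iota l != l]%SET,
      [forall l : idx d, (iota l != l) ==> (odd l != odd (iota l))],
      noncrossing iota
    & [forall l : idx d, (iota l != l) ==>
        ((l \in H) && (iota l \in H)) || ((l \in T) && (iota l \in T))]].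

Definition comb_data (d : nat) :
    {set {ffun idx d -> idx d} * {set idx d} * {set idx d}} :=
  [set D | is_comb_data D.1.1 D.1.2 D.2]%SET.

Definition npairs (d : nat) (iota : {ffun idx d -> idx d})
    (S : {set idx d}) : nat :=
  #|[set [set l; iota l]%SET | l in S]%SET|.

(* The real dimension 2s + h of the class with data set (iota, H, T). *)
Definition class_dim (d : nat)
    (D : {ffun idx d -> idx d} * {set idx d} * {set idx d}) : nat :=
  2 * npairs D.1.1 D.2 + npairs D.1.1 D.1.2.

(* Combinatorial classes correspond bijectively to combinatorial data sets:
   every data set is realized by some vector field (Branner-Dias). *)
Definition nclasses_dim (d q : nat) : nat :=
  #|[set D in comb_data d | class_dim D == q]%SET|.

Definition nclasses (d : nat) : nat := #|comb_data d|.

Local Open Scope classical_set_scope.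
Local Open Scope ring_scope.

Definition class_freq (R : realType) (d q : nat) : R :=
  (nclasses_dim d q)%:R / (nclasses d)%:R.

Definition is_discrete_distr (R : realType) (p : nat -> R) : Prop :=
  (forall q, 0 <= p q) /\ series p @ \oo --> (1 : R).

Definition mean_terms (R : realType) (p : nat -> R) : nat -> R :=
  fun q => q%:R * p q.

Definition distr_mean (R : realType) (p : nat -> R) : R :=
  limn (series (mean_terms p)).

Definition variance_terms (R : realType) (p : nat -> R) : nat -> R :=
  fun q => (q%:R - distr_mean p) ^+ 2 * p q.

Definition distr_variance (R : realType) (p : nat -> R) : R :=
  limn (series (variance_terms p)).

Definition asymp_equiv (R : realType) (a b : nat -> R) : Prop :=
  (fun n => a n / b n) @ \oo --> (1 : R).

(* The random variables Y n may live on different probability spaces; the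
   distribution functions converge at every continuity point of the limit. *)
Definition cvg_in_distribution (R : realType) (disp : nat -> measure_display)
    (Omega : forall n, measurableType (disp n))
    (P : forall n, probability (Omega n) R)
    (Y : forall n, Omega n -> R) (nu : set R -> \bar R) : Prop :=
  forall x : R, {for x, continuous (fun t : R => nu [set` `]-oo, t]])} ->
    (fun n => P n [set w | Y n w <= x]) @ \oo --> nu [set` `]-oo, x]].

(* Main.v *)
(* Put [N = d - 1]. Cut at the index [0], a data set becomes a planar tree of
   coloured arcs, and Lagrange inversion counts the trees: there are
     C(N + 1, k + 1) C(2 N, k) C(k, s) / (N + 1),   k = h + s,
   data sets with [h] pairs in [H] and [s] pairs in [T]. Since the quotients of
   neighbouring counts are rational functions of [h] and [s], summation by parts
   gives, for a uniformly chosen data set and every function [G],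
     E[(k + 1) h G(h - 1, s)] = E[(N - k) (2 N - k) G(h, s)]
                              = E[(k + 1) s G(h, s - 1)].
   Choosing powers of [k - (3 - sqrt 5) N] for [G] bounds the moments of that
   deviation, and linearizing at [k = (3 - sqrt 5) N] then turns the identities
   into an approximate Stein identity for the dimension [X = h + 2 s],
     E[(X - kappa N) g(X)] ~ lambda N E[g'(X)],
   with [kappa = 3 (3 - sqrt 5) / 2] and [lambda = (29 sqrt 5 - 60) / 10]. Here
   [g = 1] gives the mean, [g = id - kappa N] the variance, and the solution of
   the Stein equation [f' x - x f x = (x <= a) - Phi a] the limit law. The jump
   of [f'] at [a] is harmless because the same identity, applied to a ramp,
   bounds the probability of a window of bounded length. *)

From HB Require Import structures.
Require Import Defs.
From mathcomp Require Import all_boot all_order all_algebra.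
From mathcomp Require Import all_classical all_reals all_analysis.
From mathcomp Require Import measurable_realfun.
From mathcomp Require Import zify ring lra.
Import Order.TTheory GRing.Theory Num.Theory.
Import numFieldNormedType.Exports.

(** * Arc diagrams *)

(** The constants can be read off the weights. Given k, s is binomial with parameters k and 1/2,
    since only [C(k, s)] separates h from s. Adding the two outer identities shows that k settles
    where 2 (N - k) (2 N - k) is about k^2, that is k^2 - 6 k N + 4 N^2 = 0. From X = 3/2 k - (h -
    s) / 2 one gets kappa = 3/2 (3 - sqrt 5), while lambda is 9/4 of the variance rate (3 - sqrt
    5)^2 / (2 sqrt 5) of k plus 1/4 of the rate 3 - sqrt 5 of h - s. The factors in the identities
    are quadratic in k, so linearizing leaves a term in the square of the deviation of k. The second
    moment controls it for bounded g; for the variance, where g is linear, the fourth moment is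
    needed. On the counting side the parity condition couples trees of even and odd size. The
    recursion closes only on forests with prescribed parities, hence a formula for all products of
    the two generating functions is proved, by induction, although a single even tree is wanted. *)

(* An arc diagram on consecutive points, described by what happens at its first
   point: there is none, it is unmatched, or it starts an arc, of colour [true]
   for [T] and [false] for [H], that encloses the first subtree. *)
Inductive tree := Leaf | Pt of tree | Arc of bool & tree & tree.

(** The embedding into [GenTree.tree] equips [tree] with decidable equality, which membership and
    [uniq] of lists of trees require. *)
Fixpoint gen_of_tree t : GenTree.tree bool :=
  match t with
  | Leaf => GenTree.Node 0 [::]
  | Pt t => GenTree.Node 1 [:: gen_of_tree t]
  | Arc c a b => GenTree.Node 2 [:: GenTree.Leaf c; gen_of_tree a; gen_of_tree b]
  end.

Fixpoint tree_of_gen g : option tree :=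
  match g with
  | GenTree.Node 0 [::] => Some Leaf
  | GenTree.Node 1 [:: g] => omap Pt (tree_of_gen g)
  | GenTree.Node 2 [:: GenTree.Leaf c; g; g'] =>
      if (tree_of_gen g, tree_of_gen g') is (Some a, Some b)
      then Some (Arc c a b) else None
  | _ => None
  end.

Lemma gen_of_treeK : pcancel gen_of_tree tree_of_gen.
Proof. by elim=> [|t /= ->|c a /= -> b ->]. Qed.

HB.instance Definition _ := Equality.copy tree (pcan_type gen_of_treeK).

Fixpoint tree_size t : nat :=
  match t with
  | Leaf => 0
  | Pt t => (tree_size t).+1
  | Arc _ a b => (tree_size a + tree_size b).+2
  end.

(** The ends of an arc have different parity exactly when the arc encloses an even number of
    points. *)
Fixpoint even_arcs t : bool :=
  match t with
  | Leaf => true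
  | Pt t => even_arcs t
  | Arc _ a b => [&& ~~ odd (tree_size a), even_arcs a & even_arcs b]
  end.

Fixpoint arcs (c : bool) t : nat :=
  match t with
  | Leaf => 0
  | Pt t => arcs c t
  | Arc c' a b => (c' == c) + (arcs c a + arcs c b)
  end.

(** The grafts undo the removal of the root of the first tree; an arc uses up two trees, the
    enclosed one and the one that follows. The parity lists in [forests] keep the default [[::]]
    from being reached. *)
Definition graft_pt (F : seq tree) :=
  if F is t :: F' then Pt t :: F' else [::].
Definition graft_arc c (F : seq tree) :=
  if F is a :: b :: F' then Arc c a b :: F' else [::].

(* Forests with tree sizes of parities [ps] and total size [n], listed by the
   root of the first tree; [f] is a recursion bound. *)
Fixpoint forests (f : nat) (ps : seq bool) (n : nat) : seq (seq tree) :=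
  if f is f'.+1 then
    if ps is e :: ps' then
      (if e then [::] else map (cons Leaf) (forests f' ps' n)) ++
      (if n is n'.+1 then map graft_pt (forests f' (~~ e :: ps') n') else [::]) ++
      (if n is n'.+2 then
         map (graft_arc false) (forests f' [:: false, e & ps'] n') ++
         map (graft_arc true) (forests f' [:: false, e & ps'] n') else [::])
    else if n == 0 then [:: [::]] else [::]
  else [::].

Definition good_forest (ps : seq bool) n (F : seq tree) :=
  [&& map (odd \o tree_size) F == ps, all even_arcs F & sumn (map tree_size F) == n].

Lemma forests_good f ps n F : F \in forests f ps n -> good_forest ps n F.
Proof.
elim: f ps n F => [|f IH] [|e ps] n F //=.
  by case: eqP => [->|//]; rewrite inE => /eqP->.
rewrite !mem_cat => /or3P[].
- case: e => // /mapP[{}F /IH /and3P[/eqP hp he hs] ->].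
  by rewrite /good_forest /= hp eqxx he hs.
- case: n => // n /mapP[[|t {}F] /IH /and3P[/eqP hp he /eqP hs] ->] //.
  case: hp he hs => hp hp' /= /andP[he1 he2] hs.
  by rewrite /good_forest /= hp hp' he1 he2 -hs negbK eqxx addSn /=.
- case: n => [|[|n]] //.
  have H c : F \in map (graft_arc c) (forests f [:: false, e & ps] n) ->
    good_forest (e :: ps) n.+2 F.
    move=> /mapP[[|a [|b {}F]] /IH /and3P[/eqP hp he /eqP hs] ->] //.
    case: hp he hs => hpa hpb hp /= /and3P[hea heb he] hs.
    rewrite /good_forest /= hpa hea heb he -hs !addSn addnA !eqxx /= negbK andbT.
    by rewrite oddD hpa hpb hp /=.
  by rewrite mem_cat => /orP[] /H.
Qed.

(** The measure [2 * n + size ps] drops at every removal: a leaf shortens the forest, a point lowers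
    [n] by one, and an arc lowers [n] by two while adding only one tree. *)
Lemma mem_forests f ps n F : 2 * n + size ps < f ->
  good_forest ps n F -> F \in forests f ps n.
Proof.
elim: f ps n F => [|f IH] [|e ps] n F //=.
  move=> _ /and3P[]; case: F => //= _ _.
  by rewrite eq_sym => ->; rewrite inE.
move=> hf /and3P[]; case: F => [//|t F] /= /eqP[ht hF] /andP[hat haF] hn.
rewrite !mem_cat; case: t ht hat hn => [|t|c a b] /=.
- move=> <- _ hn; rewrite map_f //=; apply: IH; first lia.
  by rewrite /good_forest haF hn andbT hF eqxx.
- move=> ht hat /eqP hn; subst n; apply/orP; right; apply/orP; left.
  rewrite addSn; apply/mapP; exists (t :: F) => //.
  apply: IH => /=; first lia.
  by rewrite /good_forest /= hat haF hF -ht negbK !eqxx.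
- move=> ht /and3P[hoa ha hb] /eqP hn; subst n; apply/orP; right; apply/orP; right.
  rewrite !addSn mem_cat.
  have -> : F = behead (behead [:: a, b & F]) by [].
  suff H : [:: a, b & F] \in
      forests f [:: false, e & ps] (tree_size a + tree_size b + sumn (map tree_size F)).
    by case: c; rewrite (map_f (graft_arc _) H) ?orbT.
  apply: IH => /=; first lia.
  rewrite /good_forest /= (negbTE hoa) ha hb haF hF addnA eqxx andbT.
  by rewrite -ht oddD (negbTE hoa) negbK eqxx.
Qed.

Lemma uniq_forests f ps n : uniq (forests f ps n).
Proof.
elim: f ps n => [|f IH] [|e ps] n //=; first by case: eqP.
have U1 : uniq (if e then [::] else map (cons Leaf) (forests f ps n)).
  by case: e => //; rewrite map_inj_uniq // => ? ? [].
have U2 n' : uniq (map graft_pt (forests f (~~ e :: ps) n')).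
  rewrite map_inj_in_uniq // => [[|? ?] [|? ?]]
    /forests_good /and3P[+ _ _] /forests_good /and3P[+ _ _] //=.
  by move=> _ _ [-> ->].
have U3 c n' : uniq (map (graft_arc c) (forests f [:: false, e & ps] n')).
  rewrite map_inj_in_uniq // => [[|? [|? ?]] [|? [|? ?]]]
    /forests_good /and3P[+ _ _] /forests_good /and3P[+ _ _] //=;
    rewrite ?eqseq_cons ?andbF //.
  by move=> _ _ [-> -> ->].
(* The root of the first tree tells the concatenated pieces apart, so that only injectivity of the
   grafts on each piece is left. *)
pose head (F : seq tree) : nat :=
  match F with
  | Leaf :: _ => 0 | Pt _ :: _ => 1
  | Arc false _ _ :: _ => 2 | Arc true _ _ :: _ => 3 | [::] => 4 end.
have H1 F : F \in (if e then [::] else map (cons Leaf) (forests f ps n)) ->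
    head F = 0 by case: e {U1 U2 U3} => // /mapP[? _ ->].
have H2 n' F : F \in map graft_pt (forests f (~~ e :: ps) n') -> head F = 1.
  by move=> /mapP[[|? ?] /forests_good /and3P[//= _ _ _] ->].
have H3 c n' F : F \in map (graft_arc c) (forests f [:: false, e & ps] n') ->
    head F = if c then 3 else 2.
  by move=> /mapP[[|? [|? ?]] /forests_good /and3P[//= + _ _] ->];
    rewrite ?eqseq_cons ?andbF //; case: c.
have D (s1 s2 : seq (seq tree)) : uniq s1 -> uniq s2 ->
    (forall F G, F \in s1 -> G \in s2 -> head F <> head G) -> uniq (s1 ++ s2).
  move=> u1 u2 h; rewrite cat_uniq u1 u2 andbT; apply/hasPn => F F2.
  by apply/negP => F1; exact: h F1 F2 erefl.
have U4 n' : uniq (map (graft_arc false) (forests f [:: false, e & ps] n') ++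
               map (graft_arc true) (forests f [:: false, e & ps] n')).
  by apply: (D) => // F G /H3 -> /H3 ->.
have H4 n' F : F \in map (graft_arc false) (forests f [:: false, e & ps] n') ++
    map (graft_arc true) (forests f [:: false, e & ps] n') -> 1 < head F.
  by rewrite mem_cat => /orP[] /H3 ->.
apply: (D) => //.
  case: n {U1 H1} => [|[|n]] //; first by rewrite cats0.
  by apply: (D) => // F G /H2 -> /H4; case: (head G) => [|[|]].
move=> F G /H1 ->; rewrite mem_cat => /orP[].
  by case: n {U1 H1} => // n /H2 ->.
by case: n {U1 H1} => [|[|n]] // /H4; case: (head G).
Qed.

(** * Counting arc diagrams *)

Definition forest_count f ps n h s :=
  count (fun F => (sumn (map (arcs false) F) == h) && (sumn (map (arcs true) F) == s))
    (forests f ps n).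

Lemma forest_countS f e ps n h s :
  forest_count f.+1 (e :: ps) n h s =
    (if e then 0 else forest_count f ps n h s) +
    ((if n is n'.+1 then forest_count f (~~ e :: ps) n' h s else 0) +
     (if n is n'.+2 then
        (if h is h'.+1 then forest_count f [:: false, e & ps] n' h' s else 0) +
        (if s is s'.+1 then forest_count f [:: false, e & ps] n' h s' else 0)
      else 0)).
Proof.
rewrite /forest_count /= !count_cat; congr (_ + (_ + _)).
- by case: e => //; rewrite count_map; apply: eq_count => F /=; rewrite !add0n.
- case: n => // n; rewrite count_map; apply: eq_in_count => F.
  by case: F => [|t F] /forests_good /and3P[].
- case: n => [|[|n]] //; rewrite count_cat !count_map.
  have G F : F \in forests f [:: false, e & ps] n -> exists a b F', F = [:: a, b & F'].
    move=> /forests_good /and3P[+ _ _]; case: F => [|a [|b F]] //=.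
      by rewrite eqseq_cons andbF.
    by exists a, b, F.
  congr (_ + _).
    case: h => [|h]; [apply/eqP; rewrite -leqn0 leqNgt -has_count; apply/hasPn|
      apply: eq_in_count] => F /G[a [b [F' ->]]] //=.
    by rewrite !addSn !add0n eqSS !addnA.
  case: s => [|s]; [apply/eqP; rewrite -leqn0 leqNgt -has_count; apply/hasPn|
    apply: eq_in_count] => F /G[a [b [F' ->]]] /=; first by rewrite andbF.
  by rewrite !addSn !add0n eqSS !addnA.
Qed.

Local Open Scope ring_scope.

(* ['C(M, k - 1)], which is [0] for [k = 0] *)
Definition bin_pred M k : rat := (if k is k'.+1 then 'C(M, k') else 0%N)%:R.

Lemma bin_predS M k : 'C(M.+1, k)%:R = 'C(M, k)%:R + bin_pred M k.
Proof. by case: k => [|k]; rewrite /bin_pred ?bin0 ?addr0 // binS natrD. Qed.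

(* The coefficient of [x^m w^k] in [E^(r-j) O^j], where [E] and [O] are the
   generating functions of the trees of even and odd size; Lagrange inversion
   in [E = 1 + x O + w x E^2], [O = E + w x E O] gives this formula. *)
Definition forest_coef m k r j : rat :=
  'C(m + r, k + r)%:R / (m + r)%:R *
  (r%:R * 'C(2 * m + r.-1 + j, k)%:R + j%:R * bin_pred (2 * m + r.-1 + j) k).

Lemma forest_coef0 k r j : (0 < r)%N -> forest_coef 0 k r j = (k == 0%N)%:R.
Proof.
move=> r0; rewrite /forest_coef !add0n; case: k => [|k] /=.
  rewrite binn bin0 mulr1 /bin_pred mulr0 addr0 mul1r mulVf //.
  by rewrite pnatr_eq0 -lt0n.
by rewrite bin_small ?mul0r // ltnS leq_addl.
Qed.

(** This is [O = E + w x E O] multiplied by [E^(r-j-1) O^j]; for the explicit formula it amounts to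
    Pascal's rule. *)
Lemma forest_coef_odd m k r j : (0 < r)%N ->
  forest_coef m k r j.+1 = forest_coef m k r j +
    (if m is m'.+1 then if k is k'.+1 then forest_coef m' k' r.+1 j.+1 else 0
     else 0).
Proof.
move=> r0; case: m => [|m]; first by rewrite addr0 !forest_coef0.
case: k => [|k].
  by rewrite addr0 /forest_coef !bin0 /bin_pred !mulr0.
case: r r0 => // r _; rewrite /forest_coef.
have -> : (m + r.+2 = m.+1 + r.+1)%N by lia.
have -> : (k + r.+2 = k.+1 + r.+1)%N by lia.
have -> : (2 * m.+1 + r.+1.-1 + j.+1 = (2 * m.+1 + r + j).+1)%N by rewrite /=; lia.
have -> : (2 * m + r.+2.-1 + j.+1 = 2 * m.+1 + r + j)%N by rewrite /=; lia.
rewrite -mulrDr; congr (_ * _); rewrite bin_predS /=.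
have -> : bin_pred (2 * m.+1 + r + j).+1 k.+1 =
    bin_pred (2 * m.+1 + r + j) k.+1 + bin_pred (2 * m.+1 + r + j) k.
  by rewrite {1}/bin_pred bin_predS.
have -> : 'C(2 * m.+1 + r + j, k)%:R = bin_pred (2 * m.+1 + r + j) k.+1 by [].
by ring.
Qed.

Lemma mul_bin_pred M k : k%:R * 'C(M, k)%:R = (M.+1%:R - k%:R) * bin_pred M k.
Proof.
case: k => [|k]; rewrite /bin_pred ?mul0r ?mulr0 //.
have [kM|Mk] := leqP k M; last by rewrite !bin_small ?mulr0 // ltnW.
by rewrite -natrM mul_bin_left natrM natrB // -!natr1; ring.
Qed.

(** This is [E = 1 + x O + w x E^2] multiplied by [E^(r-j) O^j], in positive degree in [x]. *)
Lemma forest_coef_even m k r j : (j <= r)%N -> forest_coef m.+1 k r.+1 j =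
  forest_coef m.+1 k r j + (forest_coef m k r.+1 j.+1 +
    (if k is k'.+1 then forest_coef m k' r.+2 j else 0)).
Proof.
move=> jr; pose M := (2 * m + r + j).+1; pose p := (m + r).+1.
have -> : forest_coef m.+1 k r j = 'C(p, k + r)%:R / p%:R *
  (r%:R * 'C(M, k)%:R + j%:R * bin_pred M k).
  (* At [r = 0], where [r.-1] truncates, [j = 0] as well and both products vanish. *)
  rewrite /forest_coef; case: r jr @M @p => [|r] jr M p.
    by move: jr; rewrite leqn0 => /eqP->; rewrite !mul0r addr0 !mulr0.
  by have -> : (2 * m.+1 + r.+1.-1 + j = M)%N by rewrite /M /=; lia.
have -> : forest_coef m.+1 k r.+1 j = 'C(p.+1, (k + r).+1)%:R / p.+1%:R *
  (r.+1%:R * 'C(M.+1, k)%:R + j%:R * bin_pred M.+1 k).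
  rewrite /forest_coef.
  have -> : (2 * m.+1 + r.+1.-1 + j = M.+1)%N by rewrite /M /=; lia.
  by rewrite (addnS k); have -> : (m.+1 + r.+1 = p.+1)%N by rewrite /p; lia.
have -> : forest_coef m k r.+1 j.+1 = 'C(p, (k + r).+1)%:R / p%:R *
  (r.+1%:R * 'C(M, k)%:R + j.+1%:R * bin_pred M k).
  rewrite /forest_coef.
  have -> : (2 * m + r.+1.-1 + j.+1 = M)%N by rewrite /M /=; lia.
  by rewrite (addnS k); have -> : (m + r.+1 = p)%N by rewrite /p; lia.
pose c2 : rat := if k is k'.+1 then bin_pred M k' else 0.
have -> : (if k is k'.+1 then forest_coef m k' r.+2 j else 0) =
    'C(p.+1, (k + r).+1)%:R / p.+1%:R * (r.+2%:R * bin_pred M k + j%:R * c2).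
  case: k @c2 => [|k] c2; first by rewrite /c2 /bin_pred mulr0n !mulr0 ?addr0 ?mulr0.
  rewrite /forest_coef.
  have -> : (2 * m + r.+2.-1 + j = M)%N by rewrite /M /=; lia.
  have -> : (m + r.+2 = p.+1)%N by rewrite /p; lia.
  by have -> : (k + r.+2 = (k.+1 + r).+1)%N by lia.
have -> : bin_pred M.+1 k = bin_pred M k + c2.
  rewrite {1}/bin_pred /c2; case: (k) => [|k']; rewrite /bin_pred ?addr0 //.
  by rewrite -/(bin_pred M k') -bin_predS.
rewrite bin_predS.
have B1 : p.+1%:R * 'C(p, k + r)%:R = (k + r).+1%:R * 'C(p.+1, (k + r).+1)%:R :> rat.
  by rewrite -!natrM; congr _%:R; exact: mul_bin_diag.
have B2 : 'C(p.+1, (k + r).+1)%:R = 'C(p, (k + r).+1)%:R + 'C(p, k + r)%:R :> rat.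
  by rewrite binS natrD.
have p0 : p%:R != 0 :> rat by rewrite pnatr_eq0.
have p10 : p.+1%:R != 0 :> rat by rewrite pnatr_eq0.
have E1 : 'C(p, k + r)%:R = (k + r).+1%:R / p.+1%:R * 'C(p.+1, (k + r).+1)%:R :> rat.
  by rewrite mulrAC -B1 mulrAC mulfV ?mul1r //.
have E2 : 'C(p, (k + r).+1)%:R =
    (1 - (k + r).+1%:R / p.+1%:R) * 'C(p.+1, (k + r).+1)%:R :> rat.
  by rewrite mulrBl mul1r -E1 B2 addrK.
rewrite E1 E2.
move: (mul_bin_pred M k); set c0 := 'C(M, k)%:R; set c1 := bin_pred M k => Ek.
set A := 'C(_, _)%:R.
have EM : M.+1%:R = 2 * p.+1%:R - r%:R - 2 + j%:R :> rat.
  by rewrite /M /p -addnA -!natr1 natrD natrM !natrD; ring.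
rewrite {}EM in Ek.
have Ep : p.+1%:R = p%:R + 1 :> rat by rewrite natr1.
rewrite Ep in p10 Ek *.
have -> : (k + r).+1%:R = k%:R + r%:R + 1 :> rat by rewrite -natr1 natrD.
rewrite -[r.+2%:R]natr1 -[r.+1%:R]natr1 -[j.+1%:R]natr1.
have {}Ek : k%:R * c0 - (2 * (p%:R + 1) - r%:R - 2 + j%:R - k%:R) * c1 = 0.
  by rewrite Ek subrr.
apply/eqP; rewrite -subr_eq0; apply/eqP.
(* With the binomials of upper index [p] and [p.+1] all expressed by [A], the two sides differ by a
   multiple of the absorption identity [Ek]. *)
transitivity (A / (p%:R * (p%:R + 1)) *
  (k%:R * c0 - (2 * (p%:R + 1) - r%:R - 2 + j%:R - k%:R) * c1)).
  by field; rewrite p0 p10.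
by rewrite Ek mulr0.
Qed.

(** Each tree of odd size has at least one point. *)
Lemma forest_count_small f ps n h s : (n < count id ps)%N -> forest_count f ps n h s = 0%N.
Proof.
move=> nps; apply/eqP; rewrite -leqn0 leqNgt -has_count; apply/hasPn => F.
move=> /forests_good /and3P[/eqP hp _ /eqP hn]; exfalso.
suff : (count id ps <= sumn (map tree_size F))%N by rewrite hn leqNgt nps.
rewrite -hp; elim: F {hp hn} => //= t F H.
by rewrite leq_add //; case: (tree_size t) => // ?; case: (odd _).
Qed.

Lemma forest_count_nil f n h s :
  forest_count f.+1 [::] n h s = [&& n == 0, h == 0 & s == 0]%N :> nat.
Proof. by rewrite /forest_count /= ; case: n h s => [|n] [|h] [|s]. Qed.

(** Removing the first root matches [forest_coef_odd] or [forest_coef_even] according to the parity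
    of the first tree. The colours split off as ['C(h + s, s)] because the two colours of a removed
    arc add up by Pascal's rule. *)
Lemma forest_countE f m ps h s :
  (2 * (2 * m + count id ps) + size ps < f)%N -> (0 < size ps)%N ->
  (forest_count f ps (2 * m + count id ps) h s)%:R =
    forest_coef m (h + s) (size ps) (count id ps) * 'C(h + s, s)%:R.
Proof.
elim: f m ps h s => // f IH m [//|e ps] h s; rewrite ltnS => hf _.
have jps : (count id ps <= size ps)%N by apply: count_size.
have Harc m' : (m = m'.+1)%N ->
  ((if h is h'.+1 then forest_count f [:: false, e & ps] (2 * m' + count id (e :: ps)) h' s
   else 0)%N + (if s is s'.+1 then
      forest_count f [:: false, e & ps] (2 * m' + count id (e :: ps)) h s' else 0)%N)%:R =
  (if (h + s)%N is k.+1 then forest_coef m' k (size ps).+2 (count id (e :: ps))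
   else 0) * 'C(h + s, s)%:R.
  move=> mm.
  have H h' s' :
    (forest_count f [:: false, e & ps] (2 * m' + count id (e :: ps)) h' s')%:R =
    forest_coef m' (h' + s') (size ps).+2 (count id (e :: ps)) * 'C(h' + s', s')%:R.
    by apply: (IH m' [:: false, e & ps]) => //; move: hf; rewrite mm /=; lia.
  rewrite natrD; case: h hf => [|h] hf; case: s hf => [|s] hf; rewrite ?H.
  - by rewrite addr0 mul0r.
  - by rewrite !add0n add0r !binn.
  - by rewrite !addn0 addr0 !bin0.
  - by rewrite !addnS !addSn -mulrDr -natrD -binS.
have Hpt m' : (2 * m' + count id (~~ e :: ps) < 2 * m + count id (e :: ps))%N ->
   (forest_count f (~~ e :: ps) (2 * m' + count id (~~ e :: ps)) h s)%:R =
    forest_coef m' (h + s) (size ps).+1 (count id (~~ e :: ps)) * 'C(h + s, s)%:R.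
  by move=> /= ?; apply: (IH m' (~~ e :: ps)) => //=; move: hf => /=; lia.
rewrite forest_countS; case: e hf Harc Hpt => /= hf Harc Hpt.
  rewrite add0n add1n addnS natrD forest_coef_odd // mulrDl; congr (_ + _).
    by apply: Hpt; lia.
  case: m hf Harc {Hpt} => [|m] hf Harc.
    rewrite mul0r muln0 add0n; case E: (count id ps) => [//|j].
    have S h' s' : forest_count f [:: false, true & ps] j h' s' = 0%N.
      by apply: forest_count_small; rewrite /= E; lia.
    by case: h {Harc hf} => [|h]; case: s => [|s]; rewrite ?S.
  rewrite -(Harc m) // add1n.
  by have -> : (2 * m.+1 + count id ps = (2 * m + (count id ps).+1).+1)%N by lia.
(* Removing a leaf may empty the forest. The empty forest counts once, whereas [forest_coef 0 0 0 0]
   is [0], so [m' = 0] gets its own value. *)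
have Hnil m' : (m' <= m)%N -> (forest_count f ps (2 * m' + count id ps) h s)%:R =
    (if m' is m''.+1 then forest_coef m' (h + s) (size ps) (count id ps)
     else (h + s == 0)%N%:R) * 'C(h + s, s)%:R.
  case: ps hf {jps Harc Hpt} => [|e ps] hf m'm.
    case: f {IH} hf => [|f _]; first by rewrite /=; lia.
    rewrite /= forest_count_nil addn0.
    case: m' {m'm} => [|m'] /=; last by rewrite /forest_coef /= !mul0r addr0 mulr0 mul0r.
    by case: h s => [|h] [|s]; rewrite ?mul0r ?mul1r.
  rewrite (IH m' (e :: ps)) //; last by move: hf => /=; lia.
  by case: m' {m'm} => [|m'] //; rewrite forest_coef0.
(* For [m = 0] the odd trees use up all points, hence the first tree, being even, is a leaf. *)
rewrite !add0n; case: m hf Harc Hpt Hnil => [|m] hf Harc Hpt Hnil.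
  have P n : (n < count id ps)%N -> forest_count f (true :: ps) n h s = 0%N.
    by move=> ?; apply: forest_count_small => /=; lia.
  have Q n h' s' : (n < count id ps)%N -> forest_count f [:: false, false & ps] n h' s' = 0%N.
    by move=> ?; apply: forest_count_small => /=; lia.
  rewrite natrD (Hnil 0%N) // forest_coef0 // -[RHS]addr0; congr (_ + _).
  rewrite muln0 add0n; case E: (count id ps) => [//|j]; rewrite P ?E //.
  case: j E => [//|j] E; case: h {P Harc hf Hpt Hnil} => [|h]; case: s => [|s];
  by rewrite ?Q ?E.
have -> : (2 * m.+1 + count id ps = (2 * m + count id ps).+2)%N by lia.
rewrite !natrD forest_coef_even // !mulrDl; congr (_ + (_ + _)).
- by rewrite -(Hnil m.+1) //; congr (forest_count _ _ _ _ _)%:R; lia.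
- by rewrite (_ : (2 * m + count id ps).+1 = 2 * m + (1 + count id ps))%N ?Hpt //; lia.
- by rewrite -natrD -(Harc m).
Qed.

(* The number of coloured arc diagrams on [2 N] points with [h] arcs of one
   colour and [s] of the other. *)
Definition num_diagrams N h s : rat :=
  'C(N.+1, (h + s).+1)%:R * 'C(2 * N, h + s)%:R * 'C(h + s, s)%:R / N.+1%:R.

Lemma forest_count1E f N h s : (4 * N + 1 < f)%N ->
  (forest_count f [:: false] (2 * N) h s)%:R = num_diagrams N h s.
Proof.
move=> hf; have := @forest_countE f N [:: false] h s; rewrite /= !addn0 => -> //; last lia.
rewrite /forest_coef /num_diagrams /= !addn1 !addn0 mul0r addr0 mul1r.
by rewrite -!mulrA; congr (_ * _); rewrite mulrC -mulrA.
Qed.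

Lemma natr_mul_bin_left n m :
  m.+1%:R * 'C(n, m.+1)%:R = (n%:R - m%:R) * 'C(n, m)%:R :> rat.
Proof.
have [mn|nm] := leqP m n; last by rewrite !bin_small ?mulr0 // ltnW.
by rewrite -natrM mul_bin_left natrM natrB.
Qed.

Lemma num_diagramsSl N h s : (h + s).+2%:R * h.+1%:R * num_diagrams N h.+1 s =
  (N%:R - (h + s)%:R) * ((2 * N)%:R - (h + s)%:R) * num_diagrams N h s.
Proof.
have E1 := natr_mul_bin_left N.+1 (h + s).+1.
have E2 := natr_mul_bin_left (2 * N) (h + s).
have E3 : h.+1%:R * 'C((h + s).+1, s)%:R = (h + s).+1%:R * 'C(h + s, s)%:R :> rat.
  have := mul_bin_down (h + s).+1 s.
  by rewrite /= -addSn addnK addSn => /(congr1 (fun x => x%:R : rat)); rewrite !natrM => <-.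
rewrite /num_diagrams addSn.
have -> : N%:R - (h + s)%:R = N.+1%:R - (h + s).+1%:R :> rat by rewrite -!natr1; ring.
transitivity ((h + s).+2%:R * 'C(N.+1, (h + s).+2)%:R * 'C(2 * N, (h + s).+1)%:R *
  (h.+1%:R * 'C((h + s).+1, s)%:R) / N.+1%:R :> rat); first by ring.
rewrite E1 E3.
transitivity ((N.+1%:R - (h + s).+1%:R) * 'C(N.+1, (h + s).+1)%:R *
  ((h + s).+1%:R * 'C(2 * N, (h + s).+1)%:R) * 'C(h + s, s)%:R / N.+1%:R : rat); first by ring.
by rewrite E2; ring.
Qed.

Lemma num_diagramsC N h s : num_diagrams N h s = num_diagrams N s h.
Proof.
rewrite /num_diagrams (addnC s); congr (_ * _%:R / _).
by rewrite -(@bin_sub (h + s) s) ?leq_addl // addnK.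
Qed.

Lemma num_diagramsSr N h s : (h + s).+2%:R * s.+1%:R * num_diagrams N h s.+1 =
  (N%:R - (h + s)%:R) * ((2 * N)%:R - (h + s)%:R) * num_diagrams N h s.
Proof. by rewrite num_diagramsC (addnC h) num_diagramsSl [in RHS]num_diagramsC. Qed.

Lemma num_diagrams_ge0 N h s : 0 <= num_diagrams N h s.
Proof. by rewrite /num_diagrams mulr_ge0 ?invr_ge0 ?ler0n // !mulr_ge0 ?ler0n. Qed.

Lemma num_diagrams00 N : num_diagrams N 0 0 = 1.
Proof. by rewrite /num_diagrams !bin0 bin1 !mulr1 mulfV // pnatr_eq0. Qed.

Lemma num_diagrams_out N h s : (N < h + s)%N -> num_diagrams N h s = 0.
Proof. by move=> Nk; rewrite /num_diagrams bin_small ?mul0r // ltnS. Qed.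
Local Close Scope ring_scope.

(** * From arc diagrams to combinatorial data sets *)

Fixpoint partner t x : nat :=
  match t, x with
  | Leaf, _ => x
  | Pt _, 0 => 0
  | Pt t, x.+1 => (partner t x).+1
  | Arc _ a _, 0 => (tree_size a).+1
  | Arc _ a b, x.+1 =>
      if x < tree_size a then (partner a x).+1
      else if x == tree_size a then 0
      else (tree_size a).+2 + partner b (x - (tree_size a).+1)
  end.

Fixpoint color t x : bool :=
  match t, x with
  | Leaf, _ => false
  | Pt _, 0 => false
  | Pt t, x.+1 => color t x
  | Arc c _ _, 0 => c
  | Arc c a b, x.+1 =>
      if x < tree_size a then color a x
      else if x == tree_size a then c
      else color b (x - (tree_size a).+1)
  end.

Variant arc_pos m : nat -> Prop :=
  | ArcFst : arc_pos m 0
  | ArcIn x : x < m -> arc_pos m x.+1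
  | ArcLst : arc_pos m m.+1
  | ArcOut x : arc_pos m (m.+2 + x).

Lemma arc_posP m x : arc_pos m x.
Proof.
case: x => [|x]; first exact: ArcFst.
case: (ltngtP x m) => [xm|mx|->]; [exact: ArcIn| |exact: ArcLst].
have -> : x.+1 = m.+2 + (x - m.+1) by lia.
exact: ArcOut.
Qed.

Section ArcPartner.
Variables (c : bool) (a b : tree) (x : nat).

Lemma partner_in : x < tree_size a -> partner (Arc c a b) x.+1 = (partner a x).+1.
Proof. by move=> /= ->. Qed.

Lemma partner_first : partner (Arc c a b) 0 = (tree_size a).+1.
Proof. by []. Qed.

Lemma partner_last : partner (Arc c a b) (tree_size a).+1 = 0.
Proof. by rewrite /= ltnn eqxx. Qed.

Lemma partner_out :
  partner (Arc c a b) ((tree_size a).+2 + x) = (tree_size a).+2 + partner b x.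
Proof.
rewrite /= ifF; last lia.
by rewrite ifF; [congr (_ + partner b _); lia | lia].
Qed.

Lemma color_in : x < tree_size a -> color (Arc c a b) x.+1 = color a x.
Proof. by move=> /= ->. Qed.

Lemma color_first : color (Arc c a b) 0 = c.
Proof. by []. Qed.

Lemma color_last : color (Arc c a b) (tree_size a).+1 = c.
Proof. by rewrite /= ltnn eqxx. Qed.

Lemma color_out : color (Arc c a b) ((tree_size a).+2 + x) = color b x.
Proof.
rewrite /= ifF; last lia.
by rewrite ifF; [congr (color b _); lia | lia].
Qed.

End ArcPartner.

Definition partnerE := (partner_first, partner_last, partner_out, partner_in).
Definition colorE := (color_first, color_last, color_out, color_in).

(** The conditions on a data set, for functions on [nat] so that they can be cut and shifted along
    the recursion on trees; one colouring replaces the two sets [H] and [T]. *)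
Record arc_data n (f : nat -> nat) (col : nat -> bool) : Prop := ArcData {
  arc_lt x : x < n -> f x < n;
  arcK x : x < n -> f (f x) = x;
  arc_odd x : x < n -> f x <> x -> odd (f x) = ~~ odd x;
  arc_nc x y : y < n -> x < y -> y < f x -> f x < f y -> False;
  arc_color x : x < n -> col (f x) = col x }.

Lemma partner_arc_data t : even_arcs t ->
  arc_data (tree_size t) (partner t) (color t).
Proof.
elim: t => [|t IH|c a IHa b IHb] //= het.
- have [lt inv oddP nc col] := IH het.
  split=> [[|x]|[|x]|[|x]|[|x] [|y]|[|x]] //=; rewrite ?ltnS //.
  + exact: lt.
  + by move=> /inv ->.
  + by move=> xt px; rewrite oddP // => e; apply: px; rewrite e.
  + exact: nc.
  + exact: col.
- case/and3P: het => oa ea eb.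
  have [lta inva odda nca cola] := IHa ea.
  have [ltb invb oddb ncb colb] := IHb eb.
  rewrite -/(partner (Arc c a b)) -/(color (Arc c a b)).
  split.
  + move=> x; case: (arc_posP (tree_size a) x) => [|y ya||y]; rewrite ?partnerE //.
    * by rewrite !ltnS leq_addr.
    * by move=> _; have := lta _ ya; lia.
    * by move=> yb; have := ltb y; lia.
  + move=> x; case: (arc_posP (tree_size a) x) => [|y ya||y]; rewrite ?partnerE //.
    * by rewrite inva.
    * exact: lta.
    * by rewrite !addSn !ltnS ltn_add2l => /invb ->.
  + move=> x; case: (arc_posP (tree_size a) x) => [|y ya||y]; rewrite ?partnerE //.
    * by move=> _ py; rewrite /= odda // => e; apply: py; rewrite e.
    * by rewrite /= negbK (negbTE oa).
    * rewrite !addSn !ltnS ltn_add2l => yb py; rewrite /= !oddD oddb //.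
        by rewrite !addbN.
      by move=> e; apply: py; rewrite e.
  + move=> x y; case: (arc_posP (tree_size a) x) => [|x' xa||x'];
    case: (arc_posP (tree_size a) y) => [|y' ya||y']; rewrite ?partnerE //; try lia.
    * by have := lta _ ya; lia.
    * by rewrite !ltnS => _; apply: nca.
    * by have := lta _ xa; lia.
    * by rewrite !addSn !ltnS !ltn_add2l; apply: ncb.
  + move=> x; case: (arc_posP (tree_size a) x) => [|y ya||y]; rewrite ?partnerE ?colorE //.
    * by rewrite cola.
    * exact: lta.
    * by rewrite !addSn !ltnS ltn_add2l => /colb ->.
Qed.

(** The partner of [0] determines the root and, for an arc, the size of the enclosed subtree; the
    rest follows by induction. *)
Lemma partner_inj t1 t2 : tree_size t1 = tree_size t2 ->
  (forall x, x < tree_size t1 -> partner t1 x = partner t2 x) ->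
  (forall x, x < tree_size t1 -> partner t1 x <> x -> color t1 x = color t2 x) ->
  t1 = t2.
Proof.
elim: t1 t2 => [|t1 IH|c a IHa b IHb] [|t2|c' a' b'] //.
- move=> [st] hp hc; congr Pt; apply: IH => // x xt.
    by have [] := hp x.+1 xt.
  by move=> px; apply: (hc x.+1) => // -[].
- by move=> _ /(_ 0 isT).
- by move=> _ /(_ 0 isT).
rewrite ![tree_size (Arc _ _ _)]/= => -[st] hp hc.
have [sa] := hp 0 isT.
have sb : tree_size b = tree_size b' by lia.
have -> : c = c' by apply: (hc 0).
have -> : a = a'.
  apply: IHa => // x xa; have xa' : x < tree_size a' by rewrite -sa.
    have := hp x.+1; rewrite (@partner_in c a b x xa) (@partner_in c' a' b' x xa').
    by move/(_ ltac:(lia)) => [].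
  move=> px; have := hc x.+1.
  rewrite (@partner_in c a b x xa) (@color_in c a b x xa) (@color_in c' a' b' x xa').
  by apply; [lia | move=> -[]].
congr Arc; apply: IHb => // x xb.
  have := hp ((tree_size a).+2 + x); rewrite partner_out sa partner_out => H.
  by apply: (@addnI (tree_size a').+2); apply: H; lia.
have := hc ((tree_size a).+2 + x); rewrite partner_out color_out sa color_out => H px.
by apply: H; lia.
Qed.

(** The matching is cut at the partner [m.+1] of [0]. A point strictly inside this arc has its
    partner inside, as the two arcs would cross otherwise, so the inner and the outer points carry
    independent matchings. The inner number [m] is even because [m.+1] has the parity opposite to
    that of [0]. *)
Lemma partner_surj n f col : arc_data n f col ->
  exists t, [/\ tree_size t = n, even_arcs t,
    forall x, x < n -> partner t x = f x &
    forall x, x < n -> f x <> x -> color t x = col x].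
Proof.
elim/ltn_ind: n f col => -[|n] IH f col [lt inv oddP nc colP].
  by exists Leaf.
case f0: (f 0) => [|m].
  have fS x : x < n -> f x.+1 = (f x.+1).-1.+1.
    by move=> xn; have := inv x.+1 xn; case: (f x.+1) => //; rewrite f0.
  have [|t [st et pt ct]] := IH n (ltnSn n) (fun x => (f x.+1).-1) (fun x => col x.+1).
  - split=> x.
    + by move=> xn; have := lt x.+1 xn; rewrite fS.
    + by move=> xn; rewrite -fS // inv.
    + move=> xn px; have := oddP x.+1 xn; rewrite fS //= => H.
      by apply: negb_inj; rewrite H // => -[].
    + move=> y yn xy yx xy'; have := fS x; have := fS y.
      by have := nc x.+1 y.+1; lia.
    + by move=> xn; rewrite -fS // colP.
  exists (Pt t); rewrite /= st; split=> // -[|x] //= xn; first by rewrite pt // -fS.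
  by move=> px; apply: ct => // e; apply: px; rewrite fS // e.
have mn : m.+1 < n.+1 by rewrite -f0 lt.
have fm : f m.+1 = 0 by rewrite -f0 inv.
have om : ~~ odd m by have := oddP 0; rewrite f0 /= => ->.
have fne0 x : x < n.+1 -> x != m.+1 -> 0 < f x.
  by move=> xn /eqP xm; rewrite lt0n; apply/eqP => fx; apply: xm; rewrite -(inv x) // fx.
have fnem x : x < n.+1 -> x != 0 -> f x != m.+1.
  by move=> xn /eqP x0; apply/eqP => fx; apply: x0; rewrite -(inv x) // fx.
have fa x : x < m -> 0 < f x.+1 < m.+1.
  move=> xm; rewrite fne0; try lia.
  have := fnem x.+1; have := nc 0 x.+1; rewrite f0; lia.
have fb x : m.+2 + x < n.+1 -> m.+2 <= f (m.+2 + x).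
  move=> xn; have := fne0 _ xn; have := fnem _ xn; have := nc 0 (f (m.+2 + x)).
  rewrite f0 inv //; have := lt _ xn; lia.
have [|a [sa ea pa ca]] := IH m (ltnW mn) (fun x => (f x.+1).-1) (fun x => col x.+1).
- split=> x.
  + by move=> xm; have := fa x xm; lia.
  + by move=> xm; have := fa x xm; move=> ?; rewrite prednK ?inv; lia.
  + move=> xm px; have := fa x xm; have := oddP x.+1; move=> /= H H1.
    by move: H; rewrite -(prednK (n := f x.+1)); [move=> /= H; apply: negb_inj; rewrite H; lia|lia].
  + move=> y ym xy; have := fa x; have := fa y; have := nc x.+1 y.+1; lia.
  + by move=> xm; have := fa x xm; move=> ?; rewrite prednK ?colP; lia.
have [|b [sb eb pb cb]] :=
  IH (n.-1 - m) ltac:(lia) (fun x => f (m.+2 + x) - m.+2) (fun x => col (m.+2 + x)).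
- split=> x.
  + by move=> xn; have := fb x; have := lt (m.+2 + x); lia.
  + by move=> xn; have := fb x => ?; rewrite subnKC ?inv; lia.
  + move=> xn px; have := fb x => H; have := oddP (m.+2 + x).
    rewrite -{1 2}(subnKC (n := f (m.+2 + x)) (m := m.+2)); last lia.
    by rewrite !oddD => H'; apply: (@addbI (odd m.+2)); rewrite H' ?addbN //; lia.
  + move=> y yn xy; have := fb x; have := fb y; have := nc (m.+2 + x) (m.+2 + y); lia.
  + by move=> xn; have := fb x => ?; rewrite subnKC ?colP; lia.
exists (Arc (col 0) a b); split.
- by rewrite /= sa sb; lia.
- by rewrite /= sa om ea eb.
- move=> x; rewrite -sa in f0 fm fa fb *.
  case: (arc_posP (tree_size a) x) => [|y ya|_|y yb]; rewrite ?partnerE //=.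
  + by rewrite pa -?sa //; have := fa y ya; lia.
  + by rewrite pb -?sa; [have := fb y yb; lia|lia].
- move=> x; rewrite -sa in f0 fm fa fb *.
  case: (arc_posP (tree_size a) x) => [|y ya|_ _|y yb] //; rewrite ?colorE //.
  + by move=> _ py; rewrite ca -?sa //; have := fa y ya; lia.
  + by rewrite -fm colP // sa.
  + by move=> py; rewrite cb -?sa //; have := fb y yb; lia.
Qed.

(** Each arc is counted at its left end. *)
Lemma count_arcs c t :
  count (fun x => (x < partner t x) && (color t x == c)) (iota 0 (tree_size t)) =
    arcs c t.
Proof.
elim: t => [|t IH|c' a IHa b IHb] //.
  by rewrite /= add0n -(addn0 1) iotaDl count_map -IH; apply: eq_count => x /=; rewrite ltnS.
have -> : arcs c (Arc c' a b) = (c' == c) + (arcs c a + arcs c b) by [].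
rewrite [tree_size _]/= -addSn -addnS -add1n -addnA !iotaD !count_cat.
rewrite [iota 0 1]/= [count _ [:: 0]]/= !add0n add1n addn0; congr (_ + (_ + _)).
  rewrite -(addn0 1) iotaDl count_map -IHa; apply: eq_in_count => x.
  rewrite mem_iota add0n => xa.
  rewrite -[LHS]/((1 + x < partner (Arc c' a b) (1 + x)) && (color (Arc c' a b) (1 + x) == c)).
  by rewrite add1n partner_in // color_in.
have -> (p : pred nat) : count p (iota (tree_size a).+1 (tree_size b).+1) =
  p (tree_size a).+1 + count p (iota (tree_size a).+2 (tree_size b)) by [].
rewrite partner_last ltn0 add0n -[(tree_size a).+2]addn0 iotaDl count_map -IHb.
apply: eq_in_count => x _.
rewrite -[LHS]/(((tree_size a).+2 + x < partner (Arc c' a b) ((tree_size a).+2 + x)) &&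
  (color (Arc c' a b) ((tree_size a).+2 + x) == c)).
by rewrite partner_out color_out ltn_add2l.
Qed.

(** A forest with a single tree of even size; [2 * n + 2] is the least recursion bound that
    [mem_forests] accepts. *)
Definition trees n : seq tree :=
  [seq head Leaf F | F <- forests (2 * n + 2) [:: false] n].

Lemma mem_trees n t : ~~ odd n ->
  (t \in trees n) = (tree_size t == n) && even_arcs t.
Proof.
move=> on; apply/mapP/andP => [[F /forests_good + ->]|[/eqP tn et]].
  case: F => [|u [|v F]] /and3P[] //=; last by rewrite !eqseq_cons andbF.
  by rewrite andbT addn0 => _ ->.
exists [:: t] => //; apply: mem_forests => /=; first by rewrite addn2 addn1.
by rewrite /good_forest /= tn et addn0 eqxx (negbTE on).
Qed.

Lemma uniq_trees n : uniq (trees n).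
Proof.
rewrite map_inj_in_uniq ?uniq_forests // => F G.
move=> /forests_good /and3P[+ _ _] /forests_good /and3P[+ _ _].
case: F => [|u [|v F]]; case: G => [|u' [|v' G]]; rewrite /= ?eqseq_cons ?andbF //.
by move=> _ _ ->.
Qed.

Lemma count_trees N h s :
  (count (fun t => (arcs false t == h) && (arcs true t == s)) (trees (2 * N)))%:R%R
    = num_diagrams N h s.
Proof.
rewrite -(@forest_count1E (2 * (2 * N) + 2)); last by lia.
rewrite count_map; congr (_%:R)%R; apply: eq_in_count => F /forests_good /and3P[+ _ _].
by case: F => [|u [|v F]]; rewrite /= ?eqseq_cons ?andbF // !addn0.
Qed.

(** * Data sets of degree d as trees with 2 d - 2 points *)

Section Decode.
Variable d : nat.
Notation n := (2 * d - 2).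

Definition decode t : {ffun idx d -> idx d} * {set idx d} * {set idx d} :=
  ([ffun i : idx d => insubd i (partner t i)],
   [set i : idx d | (partner t i != i) && ~~ color t i],
   [set i : idx d | (partner t i != i) && color t i])%SET.

Lemma val_decode t (i : idx d) : even_arcs t -> tree_size t = n ->
  (decode t).1.1 i = partner t i :> nat.
Proof.
move=> et tn; rewrite ffunE val_insubd ifT //.
by rewrite -{2}tn; apply: (arc_lt _ _ _ (partner_arc_data t et)); rewrite tn.
Qed.

Lemma decode_comb_data t : even_arcs t -> tree_size t = n -> decode t \in comb_data d.
Proof.
move=> et tn; have [_ inv oddP nc colP] := partner_arc_data t et.
have vE i := val_decode t i et tn.
have ltn i : (i : idx d) < tree_size t by rewrite tn.
have fixE i : ((decode t).1.1 i != i) = (partner t i != i).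
  by rewrite -(inj_eq val_inj) /= vE.
rewrite inE /is_comb_data; apply/and5P; split; last (apply/andP; split).
- by apply/forallP => i; rewrite -(inj_eq val_inj) /= !vE inv.
- rewrite disjoint_subset; apply/fintype.subsetP => i.
  by rewrite !inE => /andP[-> /negbTE ->].
- apply/eqP/setP => i; rewrite !inE fixE.
  by case: (color _ _); rewrite ?andbF ?andbT ?orbF.
- apply/forallP => i; apply/implyP; rewrite fixE vE => /eqP px.
  by rewrite oddP //; case: (odd _).
- apply/forallP => i; apply/forallP => j; rewrite !vE.
  by apply/negP => /and3P[ij ji ii]; exact: (nc i j).
- apply/forallP => i; apply/implyP; rewrite fixE => px.
  rewrite !inE vE inv // colP // (eq_sym (nat_of_ord i)) px /=.
  by case: (color _ _).
Qed.

Lemma decode_inj t1 t2 : t1 \in trees n -> t2 \in trees n ->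
  decode t1 = decode t2 -> t1 = t2.
Proof.
have on : ~~ odd n by rewrite (_ : n = d.-1.*2) ?odd_double //; lia.
rewrite !mem_trees // => /andP[/eqP s1 e1] /andP[/eqP s2 e2] e.
have pE x : x < n -> partner t1 x = partner t2 x.
  by move=> xn; rewrite -(val_decode t1 (Ordinal xn)) // e val_decode.
apply: partner_inj; rewrite s1 ?s2 // => x xn px.
have [_ _ /setP /(_ (Ordinal xn))] := e.
by rewrite !inE -pE //=; move/eqP: px => ->.
Qed.

Lemma decode_surj D : D \in comb_data d -> exists2 t, t \in trees n & decode t = D.
Proof.
have on : ~~ odd n by rewrite (_ : n = d.-1.*2) ?odd_double //; lia.
case: D => [[io H] T]; rewrite inE /is_comb_data /=.
move=> /and5P[/forallP inv dis /eqP HT /forallP oddP /andP[/forallP nc /forallP par]].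
pose f x := if insub x is Some i then val (io i) else x.
pose col x := if insub x is Some i then i \in T else false.
have fE (i : idx d) : f i = io i by rewrite /f valK.
have cE (i : idx d) : col i = (i \in T) by rewrite /col valK.
have memHT i : (i \in H) || (i \in T) = (io i != i).
  by have /setP /(_ i) := HT; rewrite !inE.
have nHT i : ~~ ((i \in H) && (i \in T)) by apply/negP => /andP[/(disjointFr dis) ->].
have [|t [tn et pt ct]] := @partner_surj n f col.
- split=> x.
  + by move=> xn; rewrite (fE (Ordinal xn)).
  + by move=> xn; rewrite (fE (Ordinal xn)) fE (eqP (inv _)).
  + move=> xn; rewrite (fE (Ordinal xn)) => px.
    have := oddP (Ordinal xn); have -> : io (Ordinal xn) != Ordinal xn.
      by apply/eqP => e; apply: px; rewrite e.
    by rewrite /=; case: (odd _); case: (odd _).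
  + move=> y yn xy; rewrite (fE (Ordinal (ltn_trans xy yn))) (fE (Ordinal yn)) => yx xy'.
    have := nc (Ordinal (ltn_trans xy yn)) => /forallP /(_ (Ordinal yn)).
    by rewrite xy /= yx xy'.
  + move=> xn; rewrite (fE (Ordinal xn)) (cE (Ordinal xn)) cE.
    have := par (Ordinal xn); have := memHT (Ordinal xn); have := memHT (io (Ordinal xn)).
    have := nHT (Ordinal xn); have := nHT (io (Ordinal xn)).
    rewrite (eqP (inv _)) (eq_sym (Ordinal xn)).
    by case: (io _ != _); case: (io _ \in H); case: (io _ \in T); case: (_ \in H); case: (_ \in T).
exists t; first by rewrite mem_trees // tn eqxx et.
have pE (i : idx d) : partner t i = io i by rewrite pt ?fE.
have fixE (i : idx d) : (partner t i != i) = (io i != i).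
  by rewrite pE -(inj_eq val_inj).
have colE' (i : idx d) : io i != i -> color t i = (i \in T).
  by move=> px; rewrite ct ?cE // fE => /val_inj /eqP; exact/negP.
congr (_, _, _).
- by apply/ffunP => i; apply: val_inj; exact: etrans (val_decode t i et tn) (pE i).
- apply/setP => i; rewrite !inE fixE; have := memHT i; have := @nHT i.
  by case: eqP => [_|/eqP /colE' ->]; case: (i \in H); case: (i \in T).
- apply/setP => i; rewrite !inE fixE; have := memHT i.
  by case: eqP => [_|/eqP /colE' ->]; case: (i \in H); case: (i \in T).
Qed.

(** Every pair has exactly one element that is smaller than its partner. *)
Lemma npairs_openers (io : {ffun idx d -> idx d}) (S : {set idx d}) :
  (forall i, io (io i) = i) -> (forall i, i \in S -> io i \in S) ->
  (forall i, i \in S -> io i != i) ->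
  npairs io S = #|[set i in S | i < io i]%SET|.
Proof.
move=> inv St fx; rewrite /npairs.
rewrite -(card_in_imset (f := fun i => [set i; io i]%SET) (D := [set i in S | i < io i]%SET)).
  apply: eq_card; apply/setP/eqP; rewrite finset.eqEsubset; apply/andP; split.
    apply/fintype.subsetP => P /imsetP[i iS ->]; apply/imsetP.
    have := fx i iS; rewrite -(inj_eq val_inj) neq_ltn => /orP[lt|lt].
      by exists (io i); rewrite ?inE ?St ?inv // finset.setUC.
    by exists i; rewrite ?inE ?iS.
  apply/fintype.subsetP => P /imsetP[i]; rewrite inE => /andP[iS _] ->.
  by apply/imsetP; exists i.
move=> i j; rewrite !inE => /andP[iS ii] /andP[jS jj] /setP e.
have := e i; have := e j; rewrite !inE !eqxx /= => /orP[/eqP -> //|/eqP ji].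
move=> /esym /orP[/eqP -> //|/eqP ij]; exfalso.
by rewrite -ji in ii; rewrite -ij in jj; have := ltn_trans ii jj; rewrite ltnn.
Qed.

Lemma npairs_decode c t : even_arcs t -> tree_size t = n ->
  npairs (decode t).1.1 (if c then (decode t).2 else (decode t).1.2) = arcs c t.
Proof.
move=> et tn; have [_ inv _ _ colP] := partner_arc_data t et.
have vE i := val_decode t i et tn.
have SE (i : idx d) : (i \in if c then (decode t).2 else (decode t).1.2) =
    (partner t i != i) && (color t i == c).
  by case: (c); rewrite inE; case: (color _ _).
rewrite npairs_openers.
- rewrite -(count_arcs c t) tn -sum1_count.
  have -> : iota 0 n = index_iota 0 n by rewrite /index_iota subn0.
  rewrite big_mkord sum1_card; apply: eq_card => i; rewrite inE SE vE.
  rewrite [in RHS]/in_mem /= neq_ltn.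
  by case: (ltngtP (partner t i) i); rewrite ?andbF ?andbT.
- by move=> i; apply: val_inj => /=; rewrite !vE inv // tn.
- move=> i; rewrite !SE vE => /andP[px /eqP <-].
  by rewrite inv ?tn // colP ?tn // eqxx eq_sym px.
- by move=> i; rewrite SE -(inj_eq val_inj) /= vE => /andP[].
Qed.

End Decode.

Lemma arcs_tree_size t : 2 * (arcs false t + arcs true t) <= tree_size t.
Proof. by elim: t => [|t IH|[] a IHa b IHb] //=; lia. Qed.

(** The data sets are grouped by their numbers of pairs, both below [d] since every pair takes two
    of the [2 * d - 2] points. *)
Lemma sum_comb_data (V : nmodType) d (F : nat -> nat -> V) : 0 < d ->
  (\sum_(D in comb_data d) F (npairs D.1.1 D.1.2) (npairs D.1.1 D.2) =
   \sum_(h < d) \sum_(s < d)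
     F h s *+ count (fun t => (arcs false t == h) && (arcs true t == s))
                (trees (2 * d - 2)))%R.
Proof.
move=> d0; have on : ~~ odd (2 * d - 2) by rewrite (_ : 2 * d - 2 = d.-1.*2) ?odd_double //; lia.
have -> : (\sum_(D in comb_data d) F (npairs D.1.1 D.1.2) (npairs D.1.1 D.2) =
    \sum_(t <- trees (2 * d - 2)) F (arcs false t) (arcs true t))%R.
  rewrite -big_enum /= (perm_big (map (decode d) (trees (2 * d - 2)))) /=.
    rewrite big_map big_seq_cond [RHS]big_seq_cond; apply: eq_bigr => t.
    rewrite andbT mem_trees // => /andP[/eqP tn et].
    by have := npairs_decode d false t et tn; have := npairs_decode d true t et tn => -> ->.
  apply: uniq_perm; first exact: enum_uniq.
    by rewrite map_inj_in_uniq ?uniq_trees //; exact: decode_inj.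
  move=> D; rewrite mem_enum; apply/idP/mapP => [/decode_surj[t tt <-]|[t + ->]].
    by exists t.
  by rewrite mem_trees // => /andP[/eqP tn et]; exact: decode_comb_data.
case: d d0 on => [//|d] _ on.
rewrite pair_big /=.
pose p t : 'I_d.+1 * 'I_d.+1 := (inord (arcs false t), inord (arcs true t)).
rewrite (partition_big p xpredT) //=; apply: eq_bigr => -[h s] _ /=.
rewrite big_seq_cond -big_filter.
rewrite (eq_big_seq (fun=> F h s)); last first.
  move=> t; rewrite mem_filter mem_trees // => /andP[/andP[/andP[/eqP tn et] /eqP[<- <-]] _].
  have := arcs_tree_size t; rewrite tn => ?.
  by rewrite !inordK //; lia.
rewrite big_const_seq count_predT size_filter iter_addr_0; congr (_ *+ _)%R.
apply: eq_in_count => t tt; rewrite tt /= /p.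
move: tt; rewrite mem_trees // => /andP[/eqP tn et]; have := arcs_tree_size t; rewrite tn => ?.
by rewrite xpair_eqE -!(inj_eq val_inj) /= !inordK //; lia.
Qed.

Local Open Scope ring_scope.

(** * The law of the numbers of pairs *)

Section Expectation.
Variables (R : rcfType) (N : nat).
Implicit Types (F G : R -> R -> R) (a : R).

(* [Ex F] is the mean of [F h s] over the data sets of degree [N + 1]. The test
   functions have real arguments, so that [h - 1] is not truncated at [h = 0]. *)
Definition weight h s : R := ratr (num_diagrams N h s).
Definition Esum F : R :=
  \sum_(h < N.+1) \sum_(s < N.+1) weight h s * F h%:R s%:R.
Definition Ex F : R := Esum F / Esum (fun _ _ => 1).

Lemma weight_ge0 h s : 0 <= weight h s.
Proof. by rewrite ler0q num_diagrams_ge0. Qed.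

Lemma weight_out h s : (N < h + s)%N -> weight h s = 0.
Proof. by move=> k; rewrite /weight num_diagrams_out // rmorph0. Qed.

Lemma Esum1_gt0 : 0 < Esum (fun _ _ => 1).
Proof.
rewrite /Esum big_ord_recl /= big_ord_recl /= /weight num_diagrams00 rmorph1 mulr1.
rewrite -addrA ltr_pwDl // addr_ge0 //.
  by apply: sumr_ge0 => i _; rewrite mulr1 weight_ge0.
by apply: sumr_ge0 => i _; apply: sumr_ge0 => j _; rewrite mulr1 weight_ge0.
Qed.

Lemma eq_Ex F G : (forall h s, 0 <= h -> 0 <= s -> h + s <= N%:R -> F h s = G h s) ->
  Ex F = Ex G.
Proof.
move=> FG; congr (_ / _); apply: eq_bigr => h _; apply: eq_bigr => s _.
have [k|k] := leqP (h + s)%N N; last by rewrite weight_out ?mul0r.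
by rewrite FG // -natrD ler_nat.
Qed.

Lemma Ex_le F G : (forall h s, 0 <= h -> 0 <= s -> h + s <= N%:R -> F h s <= G h s) ->
  Ex F <= Ex G.
Proof.
move=> FG; rewrite ler_pM2r ?invr_gt0 ?Esum1_gt0 //.
apply: ler_sum => h _; apply: ler_sum => s _.
have [k|k] := leqP (h + s)%N N; last by rewrite weight_out ?mul0r.
by rewrite ler_wpM2l ?weight_ge0 // FG // -natrD ler_nat.
Qed.

Lemma ExD F G : Ex (fun h s => F h s + G h s) = Ex F + Ex G.
Proof.
rewrite /Ex -mulrDl -big_split; congr (_ / _); apply: eq_bigr => h _.
by rewrite -big_split; apply: eq_bigr => s _ /=; rewrite mulrDr.
Qed.

Lemma ExZ a F : Ex (fun h s => a * F h s) = a * Ex F.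
Proof.
rewrite /Ex mulrA; congr (_ / _); rewrite /Esum mulr_sumr; apply: eq_bigr => h _.
by rewrite mulr_sumr; apply: eq_bigr => s _; rewrite mulrCA.
Qed.

Lemma ExB F G : Ex (fun h s => F h s - G h s) = Ex F - Ex G.
Proof.
rewrite -[- Ex G]mulN1r -ExZ -ExD.
by apply: eq_Ex => h s _ _ _; rewrite mulN1r.
Qed.

Lemma Ex_cst a : Ex (fun _ _ => a) = a.
Proof.
rewrite -[RHS]mulr1 -[in RHS](divff (lt0r_neq0 Esum1_gt0)) -/(Ex (fun _ _ => 1)) -ExZ.
by apply: eq_Ex => h s _ _ _; rewrite mulr1.
Qed.

Lemma Ex_norm F : `|Ex F| <= Ex (fun h s => `|F h s|).
Proof.
rewrite ler_norml; apply/andP; split.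
  rewrite -mulN1r -ExZ; apply: Ex_le => h s _ _ _.
  by rewrite mulN1r lerNl -normrN ler_norm.
by apply: Ex_le => h s _ _ _; exact: ler_norm.
Qed.

Lemma sum_shift (a : nat -> R) : a 0%N = 0 -> a N.+1 = 0 ->
  \sum_(h < N.+1) a h = \sum_(h < N.+1) a h.+1.
Proof.
move=> a0 aN; have : \sum_(h < N.+2) a h = \sum_(h < N.+1) a h.
  by rewrite big_ord_recr /= aN addr0.
by rewrite big_ord_recl a0 add0r => <-.
Qed.

Lemma weightSl h s : (h%:R + s%:R + 2) * h.+1%:R * weight h.+1 s =
  (N%:R - (h%:R + s%:R)) * (2 * N%:R - (h%:R + s%:R)) * weight h s.
Proof.
rewrite /weight; move: (num_diagrams N h.+1 s) (num_diagrams N h s) (num_diagramsSl N h s) => x y.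
move=> /(congr1 (ratr : rat -> R)).
rewrite !rmorphM /= !rmorphB /= !ratr_nat => E.
by move: E; rewrite -addn2 natrM [(h + s + 2)%:R]natrD [(h + s)%:R]natrD.
Qed.

Lemma weightSr h s : (h%:R + s%:R + 2) * s.+1%:R * weight h s.+1 =
  (N%:R - (h%:R + s%:R)) * (2 * N%:R - (h%:R + s%:R)) * weight h s.
Proof.
rewrite /weight; move: (num_diagrams N h s.+1) (num_diagrams N h s) (num_diagramsSr N h s) => x y.
move=> /(congr1 (ratr : rat -> R)).
rewrite !rmorphM /= !rmorphB /= !ratr_nat => E.
by move: E; rewrite -addn2 natrM [(h + s + 2)%:R]natrD [(h + s)%:R]natrD.
Qed.

(** The shift of [h] has no boundary terms: the factor [h] vanishes at [0] and the weight vanishes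
    at [N.+1]. *)
Lemma Ex_shiftl G :
  Ex (fun h s => (N%:R - (h + s)) * (2 * N%:R - (h + s)) * G h s) =
  Ex (fun h s => (h + s + 1) * h * G (h - 1) s).
Proof.
congr (_ / _); rewrite /Esum exchange_big [RHS]exchange_big /=.
apply: eq_bigr => s _; rewrite [RHS](sum_shift (fun h => weight h s *
   ((h%:R + s%:R + 1) * h%:R * G (h%:R - 1) s%:R))).
- apply: eq_bigr => h _; transitivity ((N%:R - (h%:R + s%:R)) *
    (2 * N%:R - (h%:R + s%:R)) * weight h s * G h%:R s%:R); first by ring.
  rewrite -weightSl.
  by rewrite -[h.+1%:R]natr1 addrK; ring.
- by rewrite mulr0 mul0r mulr0.
- by rewrite weight_out ?mul0r // addSn ltnS leq_addr.
Qed.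

Lemma Ex_shiftr G :
  Ex (fun h s => (N%:R - (h + s)) * (2 * N%:R - (h + s)) * G h s) =
  Ex (fun h s => (h + s + 1) * s * G h (s - 1)).
Proof.
congr (_ / _); apply: eq_bigr => h _.
rewrite [RHS](sum_shift (fun s => weight h s *
   ((h%:R + s%:R + 1) * s%:R * G h%:R (s%:R - 1)))).
- apply: eq_bigr => s _; transitivity ((N%:R - (h%:R + s%:R)) *
    (2 * N%:R - (h%:R + s%:R)) * weight h s * G h%:R s%:R); first by ring.
  rewrite -weightSr.
  by rewrite -[s.+1%:R]natr1 addrK; ring.
- by rewrite mulr0 mul0r mulr0.
- by rewrite weight_out ?mul0r // addnS ltnS leq_addl.
Qed.

(** Both shift identities, taken for [G] divided by [h + s + 2], have the same left side; after the
    shift the divisor cancels the factor [h + s + 1]. *)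
Lemma Ex_swap G : Ex (fun h s => h * G (h - 1) s) = Ex (fun h s => s * G h (s - 1)).
Proof.
have := Ex_shiftl (fun h s => G h s / (h + s + 2)); rewrite Ex_shiftr => E.
have D (h s : R) : 0 <= h -> 0 <= s -> h + s + 1 != 0.
  by move=> h0 s0; apply: lt0r_neq0; lra.
transitivity (Ex (fun h s => (h + s + 1) * h * (G (h - 1) s / (h - 1 + s + 2)))).
  apply: eq_Ex => h s h0 s0 _; have -> : h - 1 + s + 2 = h + s + 1 by ring.
  by rewrite mulrC; field; exact: D.
rewrite -E; apply: eq_Ex => h s h0 s0 _.
have -> : h + (s - 1) + 2 = h + s + 1 by ring.
by rewrite [RHS]mulrC; field; exact: D.
Qed.

End Expectation.

(** * Polynomial inequalities for the moment bounds *)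

Section Pointwise.
Variables (R : realFieldType) (x k t r : R).
Hypotheses (x1 : 1 <= x) (k0 : 0 <= k) (kx : k <= x).

Lemma mulN_le_sqr : - (k * t) <= x * (t ^+ 2 + 1) / 2.
Proof.
have A : 0 <= k * (t + 1) ^+ 2 by rewrite mulr_ge0 ?sqr_ge0.
have B : k * (t ^+ 2 + 1) <= x * (t ^+ 2 + 1).
  by rewrite ler_wpM2r // addr_ge0 ?sqr_ge0.
by lra.
Qed.

Hypotheses (tx : t <= 24 / 100 * x) (r_ge : 2236 / 1000 <= r).

(** To be read with [x = N], [k = h + s], [t] the deviation of [k] from its centre and [r = sqrt5].
    The restoring term exceeds [4.47 x t^2]; the cubic term takes at most [0.24] of this coefficient
    and [k t] at most [0.5], which leaves more than [7/2]. *)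
Lemma moment2_bound : - (2 * r * x * t ^+ 2 - t ^+ 3 + k * t) + k ^+ 2 + k <=
  x * (x + 3 / 2) - 7 / 2 * x * t ^+ 2.
Proof.
have t2 := sqr_ge0 t.
have T3 : t ^+ 3 <= 24 / 100 * x * t ^+ 2 by rewrite exprS ler_wpM2r.
have K := mulN_le_sqr.
have K2 : k ^+ 2 <= x ^+ 2 by rewrite ler_pXn2r // nnegrE (le_trans k0).
have P : 0 <= x * t ^+ 2 by rewrite mulr_ge0 // (le_trans ler01).
have S : 2236 / 1000 * (x * t ^+ 2) <= r * (x * t ^+ 2) by rewrite ler_wpM2r.
move: T3 K K2 P S kx; lra.
Qed.

(** Here [3 t^2 - 3 t + 1] is [t^3 - (t - 1)^3], the increment of the test function; the balance is
    the one of [moment2_bound]. *)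
Lemma moment4_bound :
  - (2 * r * x * t ^+ 4 - t ^+ 5 + k * t ^+ 3) + (k ^+ 2 + k) * (3 * t ^+ 2 - 3 * t + 1) <=
  x * t ^+ 2 / 2 + 2 * x ^+ 2 * (9 / 2 * t ^+ 2 + 5 / 2) - 7 / 2 * x * t ^+ 4.
Proof.
have t2 := sqr_ge0 t.
have x0 : 0 <= x by rewrite (le_trans ler01).
have t4 : 0 <= t ^+ 4 by rewrite (exprM t 2 2) sqr_ge0.
have T5 : t ^+ 5 <= 24 / 100 * x * t ^+ 4 by rewrite exprS ler_wpM2r.
have K : - (k * t ^+ 3) <= x * (t ^+ 4 + t ^+ 2) / 2.
  have A : 0 <= k * t ^+ 2 * (t + 1) ^+ 2 by rewrite mulr_ge0 ?sqr_ge0 // mulr_ge0.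
  have B : k * (t ^+ 4 + t ^+ 2) <= x * (t ^+ 4 + t ^+ 2) by rewrite ler_wpM2r ?addr_ge0.
  by move: A B; lra.
have K2 : k ^+ 2 + k <= 2 * x ^+ 2.
  have : k ^+ 2 <= x ^+ 2 by rewrite ler_pXn2r.
  have : x * 1 <= x * x by rewrite ler_wpM2l.
  by move: kx; lra.
have Q : (k ^+ 2 + k) * (3 * t ^+ 2 - 3 * t + 1) <= 2 * x ^+ 2 * (9 / 2 * t ^+ 2 + 5 / 2).
  have q0 : 0 <= 3 * t ^+ 2 - 3 * t + 1.
    by have := sqr_ge0 (t - 1 / 2); lra.
  apply: le_trans (ler_wpM2r q0 K2) _; rewrite ler_wpM2l ?mulr_ge0 ?sqr_ge0 //.
  by have := sqr_ge0 (t + 1); lra.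
have P : 0 <= x * t ^+ 4 by rewrite mulr_ge0.
have S : 2236 / 1000 * (x * t ^+ 4) <= r * (x * t ^+ 4) by rewrite ler_wpM2r.
move: T5 K Q P S; lra.
Qed.

End Pointwise.

(** * Moments of the number of pairs and the approximate Stein identity *)

Section Moments.
Variables (R : rcfType) (N : nat).
Hypothesis N_gt0 : (0 < N)%N.
Notation n := (N%:R : R).
Notation Ex := (Ex R N).

Definition sqrt5 : R := Num.sqrt 5.

Lemma sqrt5_sq : sqrt5 * sqrt5 = 5.
Proof. by rewrite -expr2 sqr_sqrtr ?ler0n. Qed.

Lemma sqrt5_bounds : 2236 / 1000 < sqrt5 < 2237 / 1000.
Proof.
have s0 : 0 <= sqrt5 by rewrite sqrtr_ge0.
have := sqrt5_sq; move: sqrt5 s0 => x x0 xx.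
by apply/andP; split; nra.
Qed.

Definition pair_rate : R := 3 - sqrt5.

Lemma pair_rate_eq : pair_rate ^+ 2 = 6 * pair_rate - 4.
Proof. by have := sqrt5_sq; rewrite /pair_rate; move: sqrt5 => x E; ring: E. Qed.

Lemma pair_rate_bounds : 763 / 1000 < pair_rate < 764 / 1000.
Proof.
have := sqrt5_bounds; rewrite /pair_rate; move: sqrt5 => x.
by move=> /andP[? ?]; apply/andP; split; lra.
Qed.

Lemma n_ge1 : 1 <= n.
Proof. by rewrite ler1n. Qed.

Definition pair_dev (h s : R) : R := h + s - pair_rate * n.

Lemma pair_dev_le h s : h + s <= n -> pair_dev h s <= 24 / 100 * n.
Proof.
have /andP[c1 _] := pair_rate_bounds => hs.
have : 763 / 1000 * n <= pair_rate * n by rewrite ler_wpM2r ?ler0n // ltW.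
by rewrite /pair_dev; move: hs n_ge1; move: pair_rate n => c x; lra.
Qed.

(* The polynomial [2 (n - k) (2 n - k) - k (k + 1)] vanishes to leading order
   at [k = pair_rate * n], which identifies [pair_rate * n] as the centre of [k]. *)
Lemma Ex_pair_dev_id (g : R -> R) :
  Ex (fun h s => (2 * sqrt5 * n * pair_dev h s - pair_dev h s ^+ 2 + (h + s)) * g (pair_dev h s)) =
  Ex (fun h s => ((h + s) ^+ 2 + (h + s)) * (g (pair_dev h s) - g (pair_dev h s - 1))).
Proof.
pose Z h s : R := (N%:R - (h + s)) * (2 * N%:R - (h + s)) * (2 * g (pair_dev h s)) -
  ((h + s + 1) * h * g (pair_dev (h - 1) s) + (h + s + 1) * s * g (pair_dev h (s - 1))).
have Z0 : Ex Z = 0.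
  rewrite ExB ExD -(Ex_shiftl R N (fun h s => g (pair_dev h s))).
  rewrite -(Ex_shiftr R N (fun h s => g (pair_dev h s))) -ExD -ExB -[RHS](Ex_cst R N 0).
  by apply: eq_Ex => h s _ _ _; ring.
apply/eqP; rewrite eq_sym -subr_eq0 -ExB; apply/eqP; rewrite -[RHS]Z0; apply: eq_Ex => h s _ _ _.
rewrite /Z.
have -> : pair_dev (h - 1) s = pair_dev h s - 1 by rewrite /pair_dev; ring.
have -> : pair_dev h (s - 1) = pair_dev h s - 1 by rewrite /pair_dev; ring.
move: (g _) (g _) => u v; rewrite /pair_dev.
have -> : sqrt5 = 3 - pair_rate by rewrite /pair_rate; ring.
have := pair_rate_eq; move: pair_rate n => c x=> E.
by ring: E.
Qed.

(** For [g = id] the pointwise bound integrates to [7/2 n E[t^2] <= n (n + 3/2)] with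
    [t = pair_dev], and [n >= 1] absorbs the [3/2]. *)
Lemma Ex_pair_dev2 : Ex (fun h s => pair_dev h s ^+ 2) <= n.
Proof.
have := Ex_pair_dev_id id => /eqP; rewrite eq_sym -subr_eq0 -ExB => /eqP Z0.
suff : 0 <= Ex (fun h s => n * (n + 3 / 2) + - (7 / 2 * n) * pair_dev h s ^+ 2).
  rewrite ExD Ex_cst ExZ; set e := Ex _; have := n_ge1; move: n e=> x e x1 H.
  have : 0 <= x * (x + 3 / 2 - 7 / 2 * e) by lra.
  by rewrite pmulr_rge0; lra.
rewrite -Z0; apply: Ex_le => h s h0 s0 hs; have /andP[/ltW r1 _] := sqrt5_bounds.
have := moment2_bound _ _ _ _ _ n_ge1 (addr_ge0 h0 s0) hs (pair_dev_le h s hs) r1.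
by rewrite /=; lra.
Qed.

Lemma Ex_pair_dev4 : Ex (fun h s => pair_dev h s ^+ 4) <= 5 * n ^+ 2.
Proof.
have := Ex_pair_dev_id (fun t => t ^+ 3) => /eqP; rewrite eq_sym -subr_eq0 -ExB => /eqP Z0.
suff : 0 <= Ex (fun h s => 5 * n ^+ 2 + (n / 2 + 9 * n ^+ 2) * pair_dev h s ^+ 2 +
    - (7 / 2 * n) * pair_dev h s ^+ 4).
  rewrite ExD ExD Ex_cst !ExZ.
  have := Ex_pair_dev2; set e := Ex _; set f := Ex _.
  have := n_ge1; move: n e f=> x e f x1 ex.
  have : (x / 2 + 9 * x ^+ 2) * e <= (x / 2 + 9 * x ^+ 2) * x.
    by rewrite ler_wpM2l // addr_ge0 ?mulr_ge0 ?sqr_ge0 //; lra.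
  move=> A H; have : 0 <= x * (5 * x + x / 2 + 9 * x ^+ 2 - 7 / 2 * f) by lra.
  rewrite pmulr_rge0; last by lra.
  have : x * 1 <= x * x by rewrite ler_wpM2l //; lra.
  by lra.
rewrite -Z0; apply: Ex_le => h s h0 s0 hs; have /andP[/ltW r1 _] := sqrt5_bounds.
have := moment4_bound _ _ _ _ _ n_ge1 (addr_ge0 h0 s0) hs (pair_dev_le h s hs) r1.
by rewrite /=; lra.
Qed.

Lemma Ex_k_le : Ex (fun h s => h + s) <= n.
Proof. by rewrite -[leRHS](Ex_cst R N); apply: Ex_le. Qed.

(** [Ex_swap] for [G = h - s] gives [E[(h - s)^2] = E[h + s]], the variance of a sum of [k]
    independent signs. *)
Lemma Ex_diff2 : Ex (fun h s => (h - s) ^+ 2) <= n.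
Proof.
apply: le_trans Ex_k_le; rewrite -subr_le0 -ExB.
have /eqP := Ex_swap R N (fun h s => h - s); rewrite -subr_eq0 -ExB => /eqP E.
by rewrite -E; apply: Ex_le => h s _ _ _; rewrite le_eqVlt; apply/orP; left; apply/eqP; ring.
Qed.

Definition dim_dev (h s : R) : R := h + 2 * s - 3 / 2 * pair_rate * n.
(** The factor that turns the restoring term [2 sqrt5 n pair_dev] of [k] into [3/2 pair_dev], the
    share of [k] in [dim_dev]. Then [driftl] and [driftr] are the coefficients of the steps of
    length [1] and [2] of the dimension, and [driftl + 2 driftr] acts as its local variance. *)
Definition bcoef : R := 3 / 4 / (sqrt5 * n).
Definition driftl (h s : R) : R := bcoef * (h + s + 1) * h - h / 2.
Definition driftr (h s : R) : R := bcoef * (h + s + 1) * s + s / 2.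
Definition var_rate : R := (29 * sqrt5 - 60) / 10.

Lemma bcoefn : bcoef * n * sqrt5 = 3 / 4.
Proof.
have /andP[r1 _] := sqrt5_bounds; have := n_ge1 => n1.
rewrite /bcoef; field; apply/andP; split; apply: lt0r_neq0; lra.
Qed.

Lemma bcoef_ge0 : 0 <= bcoef.
Proof.
have /andP[r1 _] := sqrt5_bounds.
by rewrite /bcoef divr_ge0 ?mulr_ge0 ?ler0n //; lra.
Qed.

Lemma bcoefn_bounds : 335 / 1000 <= bcoef * n <= 336 / 1000.
Proof.
have /andP[r1 r2] := sqrt5_bounds; have := bcoefn.
have : 0 <= bcoef * n by rewrite mulr_ge0 ?bcoef_ge0 ?ler0n.
move: (bcoef * n) sqrt5 r1 r2 => b r r1 r2 b0 E.
have A : b * (2236 / 1000) <= b * r by rewrite ler_wpM2l // ltW.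
have B : b * r <= b * (2237 / 1000) by rewrite ler_wpM2l // ltW.
by apply/andP; split; lra.
Qed.

(** Since [dim_dev = 3/2 pair_dev - (h - s) / 2], adding [bcoef] times the mean-zero [Z] removes the
    first part and half of the mean-zero [W] the second. Besides the increments of [g], only terms
    in [pair_dev ^+ 2] and [h + s] survive. *)
Lemma stein_id (g : R -> R) :
  Ex (fun h s => dim_dev h s * g (h + 2 * s)) =
  Ex (fun h s => driftl h s * (g (h + 2 * s) - g (h + 2 * s - 1)) +
                 driftr h s * (g (h + 2 * s) - g (h + 2 * s - 2))) +
  bcoef * Ex (fun h s => (pair_dev h s ^+ 2 - (h + s)) * g (h + 2 * s)).
Proof.
pose Z h s : R := (N%:R - (h + s)) * (2 * N%:R - (h + s)) * (2 * g (h + 2 * s)) -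
  ((h + s + 1) * h * g (h - 1 + 2 * s) + (h + s + 1) * s * g (h + 2 * (s - 1))).
have Z0 : Ex Z = 0.
  rewrite ExB ExD -(Ex_shiftl R N (fun h s => g (h + 2 * s))).
  rewrite -(Ex_shiftr R N (fun h s => g (h + 2 * s))) -ExD -ExB -[RHS](Ex_cst R N 0).
  by apply: eq_Ex => h s _ _ _; ring.
pose W h s : R := h * g (h - 1 + 2 * s) - s * g (h + 2 * (s - 1)).
have W0 : Ex W = 0 by rewrite ExB (Ex_swap R N (fun h s => g (h + 2 * s))) subrr.
transitivity (Ex (fun h s => dim_dev h s * g (h + 2 * s)) + bcoef * Ex Z + 2^-1 * Ex W).
  by rewrite Z0 W0 !mulr0 !addr0.
rewrite -!ExZ -!ExD; apply: eq_Ex => h s _ _ _; rewrite /Z /W.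
have -> : h - 1 + 2 * s = h + 2 * s - 1 by ring.
have -> : h + 2 * (s - 1) = h + 2 * s - 2 by ring.
rewrite /dim_dev /driftl /driftr /pair_dev.
have E := pair_rate_eq; have := bcoefn; have -> : sqrt5 = 3 - pair_rate by rewrite /pair_rate; ring.
move: (g (h + 2 * s)) (g (h + 2 * s - 1)) (g (h + 2 * s - 2)) bcoef pair_rate E n.
move=> u v w b c E x B.
have B2 : b * x * (8 - 6 * c) = 3 / 2 * c.
  have {}E : b * x * c ^+ 2 = b * x * (6 * c - 4) by rewrite E.
  have {}B : b * x * (3 - c) * c = 3 / 4 * c by rewrite B.
  lra.
have : u * (h + 2 * s - 3 / 2 * c * x + b * (2 * (x - (h + s)) * (2 * x - (h + s))) -
   b * (h + s + 1) * (h + s) + (h - s) / 2 - b * ((h + s - c * x) ^+ 2 - (h + s))) = 0.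
  rewrite (_ : _ - _ = 0) ?mulr0 //.
  have {}E : b * x * x * c ^+ 2 = b * x * x * (6 * c - 4) by rewrite E.
  have {}B : b * x * (3 - c) * (h + s) = 3 / 4 * (h + s) by rewrite B.
  have {}B2 : b * x * (8 - 6 * c) * x = 3 / 2 * c * x by rewrite B2.
  lra.
by move=> H; lra.
Qed.

Lemma Ex_norm_le F G :
  (forall h s, 0 <= h -> 0 <= s -> h + s <= n -> `|F h s| <= G h s) -> `|Ex F| <= Ex G.
Proof. by move=> FG; apply: le_trans (Ex_norm _ _ _) _; apply: Ex_le. Qed.

Lemma bcoef_k h s : 0 <= h -> 0 <= s -> h + s <= n ->
  0 <= bcoef * (h + s + 1) <= 68 / 100.
Proof.
move=> h0 s0 hs; rewrite mulr_ge0 ?bcoef_ge0 ?addr_ge0 //=.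
have /andP[_ b2] := bcoefn_bounds.
have : bcoef * (h + s + 1) <= bcoef * (2 * n).
  by rewrite ler_wpM2l ?bcoef_ge0 //; have := n_ge1; lra.
by lra.
Qed.

Lemma driftl_le h s : 0 <= h -> 0 <= s -> h + s <= n -> `|driftl h s| <= n.
Proof.
move=> h0 s0 hs; have /andP[b1 b2] := bcoef_k h s h0 s0 hs.
rewrite /driftl; move: (bcoef * _) b1 b2 => b b1 b2.
have A : 0 <= b * h by rewrite mulr_ge0.
have B : b * h <= 68 / 100 * h by rewrite ler_wpM2r.
by rewrite ler_norml; apply/andP; split; lra.
Qed.

Lemma driftr_le h s : 0 <= h -> 0 <= s -> h + s <= n -> `|driftr h s| <= 2 * n.
Proof.
move=> h0 s0 hs; have /andP[b1 b2] := bcoef_k h s h0 s0 hs.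
rewrite /driftr; move: (bcoef * _) b1 b2 => b b1 b2.
have A : 0 <= b * s by rewrite mulr_ge0.
have B : b * s <= 68 / 100 * s by rewrite ler_wpM2r.
by rewrite ler_norml; apply/andP; split; lra.
Qed.

(** To leading order the left expression vanishes at [pair_dev = 0] and [h = s]. Expanded there, it
    has bounded coefficients in [pair_dev] and [h - s], because [bcoef] times anything of size [n]
    is bounded. *)
Lemma drift_le h s : 0 <= h -> 0 <= s -> h + s <= n ->
  `|driftl h s + 2 * driftr h s - var_rate * n| <= 2 * `|pair_dev h s| + 2 * `|h - s| + 1.
Proof.
move=> h0 s0 hs; have /andP[b1 b2] := bcoef_k h s h0 s0 hs.
have /andP[B1 B2] := bcoefn_bounds; have b0 := bcoef_ge0.
have /andP[c1 c2] := pair_rate_bounds.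
have -> : driftl h s + 2 * driftr h s - var_rate * n =
  3 / 2 * (bcoef * pair_dev h s) * pair_dev h s + 3 * (bcoef * n * pair_rate) * pair_dev h s +
  3 / 2 * (bcoef * (h + s)) - (bcoef * (h + s + 1)) * (h - s) / 2 + pair_dev h s / 4
  - 3 / 4 * (h - s).
  have L : var_rate = 3 / 2 * (bcoef * n) * pair_rate ^+ 2 + pair_rate / 4.
    rewrite /var_rate pair_rate_eq; have := bcoefn.
    have -> : pair_rate = 3 - sqrt5 by []; move: (bcoef * n) => b.
    have := sqrt5_sq; move: sqrt5 => r E B.
    have F : b = 3 / 20 * r.
      have : b * (r * r) = 3 / 4 * r by rewrite mulrA B.
      by rewrite E; lra.
    rewrite {}F; lra.
  by rewrite L /driftl /driftr /pair_dev; field.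
have K1 : `|bcoef * pair_dev h s| <= 336 / 1000.
  rewrite normrM ger0_norm //; apply: le_trans B2; rewrite ler_wpM2l //.
  have A : 0 <= pair_rate * n by rewrite mulr_ge0 ?ler0n //; lra.
  have B : pair_rate * n <= 1 * n by rewrite ler_wpM2r ?ler0n //; lra.
  by rewrite /pair_dev ler_norml; apply/andP; split; lra.
have K2 : `|bcoef * n * pair_rate| <= 26 / 100.
  have c0 : 0 <= pair_rate by lra.
  have A : 0 <= bcoef * n * pair_rate := mulr_ge0 (mulr_ge0 b0 (ler0n _ _)) c0.
  rewrite ger0_norm //.
  have : bcoef * n * pair_rate <= 336 / 1000 * pair_rate by rewrite ler_wpM2r //; lra.
  by lra.
have K3 : `|bcoef * (h + s)| <= 336 / 1000.
  rewrite normrM !ger0_norm ?addr_ge0 //; apply: le_trans B2.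
  by rewrite ler_wpM2l.
have K4 : `|bcoef * (h + s + 1)| <= 68 / 100 by rewrite ger0_norm.
move: K1 K2 K3 K4; move: (h - s) (pair_dev h s) (bcoef * pair_dev h s) (bcoef * n * pair_rate)
  (bcoef * (h + s)) (bcoef * (h + s + 1)) => d t u v w y K1 K2 K3 K4.
clear h0 s0 hs b1 b2 B1 B2 b0 c1 c2.
have A1 : `|3 / 2 * u * t| <= 504 / 1000 * `|t|.
  by rewrite normrM ler_wpM2r // normrM ger0_norm; lra.
have A2 : `|3 * v * t| <= 78 / 100 * `|t|.
  by rewrite normrM ler_wpM2r // normrM ger0_norm; lra.
have A4 : `|y * d| <= 68 / 100 * `|d| by rewrite normrM ler_wpM2r.
move: K3 A1 A2 A4 (ler_norm t) (ler_norm (- t)) (ler_norm d) (ler_norm (- d)).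
rewrite !normrN !ler_norml => /andP[? ?] /andP[? ?] /andP[? ?] /andP[? ?] ? ? ? ?.
by apply/andP; split; lra.
Qed.

End Moments.

(** * Mean and variance of the dimension up to lower order *)

Section Estimates.
Variables (R : rcfType) (N : nat).
Hypothesis N_gt0 : (0 < N)%N.
Notation n := (N%:R : R).
Notation Ex := (Ex R N).
Notation pair_dev := (pair_dev R N).
Notation dim_dev := (dim_dev R N).

Definition sqrt_size : R := Num.sqrt n.

Lemma sqrt_size_sq : sqrt_size * sqrt_size = n.
Proof. by rewrite -expr2 sqr_sqrtr ?ler0n. Qed.

Lemma sqrt_size_ge1 : 1 <= sqrt_size.
Proof. by rewrite -[leLHS]sqrtr1 ler_sqrt ?ltr01 ?ltr0n // ler1n. Qed.

Lemma sqrt_size_gt0 : 0 < sqrt_size.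
Proof. exact: lt_le_trans ltr01 sqrt_size_ge1. Qed.

Lemma norm_le_sqrt_size (x : R) : `|x| <= (sqrt_size^-1 * x ^+ 2 + sqrt_size) / 2.
Proof.
have r0 := sqrt_size_gt0; have := sqr_ge0 (`|x| - sqrt_size); rewrite -(real_normK (num_real x)).
move: (`|x|) => y H; rewrite -(ler_pM2l r0).
have -> : sqrt_size * ((sqrt_size^-1 * y ^+ 2 + sqrt_size) / 2) = (y ^+ 2 + sqrt_size ^+ 2) / 2.
  by field; apply: lt0r_neq0.
by lra.
Qed.

(** A pointwise arithmetic-geometric mean inequality at scale [sqrt_size] stands in for
    Cauchy-Schwarz. *)
Lemma Ex_norm_sqrt_size F m : Ex (fun h s => F h s ^+ 2) <= m * n ->
  Ex (fun h s => `|F h s|) <= (m + 1) / 2 * sqrt_size.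
Proof.
move=> Fm; have r0 := sqrt_size_gt0.
apply: le_trans (_ : Ex (fun h s => 2^-1 * sqrt_size^-1 * F h s ^+ 2 + sqrt_size / 2) <= _).
  by apply: Ex_le => h s _ _ _; have := norm_le_sqrt_size (F h s); lra.
rewrite ExD Ex_cst ExZ.
have : 2^-1 * sqrt_size^-1 * Ex (fun h s => F h s ^+ 2) <= 2^-1 * sqrt_size^-1 * (m * n).
  by rewrite ler_wpM2l // mulr_ge0 ?invr_ge0 // ltW.
have -> : 2^-1 * sqrt_size^-1 * (m * n) = m / 2 * sqrt_size.
  by rewrite -sqrt_size_sq; field; apply: lt0r_neq0.
by lra.
Qed.

Lemma Ex_pair_dev_norm : Ex (fun h s => `|pair_dev h s|) <= sqrt_size.
Proof.
have := Ex_norm_sqrt_size (fun h s => pair_dev h s) 1.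
rewrite mul1r => /(_ (Ex_pair_dev2 _ _ N_gt0)).
by lra.
Qed.

Lemma Ex_diff_norm : Ex (fun h s => `|h - s|) <= sqrt_size.
Proof.
have := Ex_norm_sqrt_size (fun h s => h - s) 1; rewrite mul1r => /(_ (Ex_diff2 _ _)).
by lra.
Qed.

Lemma dim_devE h s : dim_dev h s = 3 / 2 * pair_dev h s - (h - s) / 2.
Proof. by rewrite /dim_dev /pair_dev; field. Qed.

Lemma Ex_dim_dev2 : Ex (fun h s => dim_dev h s ^+ 2) <= 5 * n.
Proof.
apply: le_trans (_ : Ex (fun h s => 9 / 2 * pair_dev h s ^+ 2 + 2^-1 * (h - s) ^+ 2) <= _).
  apply: Ex_le => h s _ _ _; rewrite dim_devE; move: (pair_dev h s) (h - s) => t d.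
  by have := sqr_ge0 (3 * t + d); lra.
rewrite ExD !ExZ; have := Ex_pair_dev2 R _ N_gt0; have := Ex_diff2 R N; lra.
Qed.

Lemma Ex_dim_dev_norm : Ex (fun h s => `|dim_dev h s|) <= 3 * sqrt_size.
Proof. by have := Ex_norm_sqrt_size (fun h s => dim_dev h s) 5 Ex_dim_dev2; lra. Qed.

(** [bcoef] is of order [1 / n], while [E[pair_dev^2]] and [E[h + s]] are at most [n]. *)
Lemma Ex_remainder (g : R -> R) C : (forall x, `|g x| <= C) ->
  `|bcoef R N * Ex (fun h s => (pair_dev h s ^+ 2 - (h + s)) * g (h + 2 * s))| <= C.
Proof.
move=> gC; have C0 : 0 <= C := le_trans (normr_ge0 _) (gC 0).
have b0 := bcoef_ge0 R N; have /andP[_ b1] := bcoefn_bounds R _ N_gt0.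
rewrite normrM ger0_norm //.
apply: le_trans (_ : bcoef R N * (2 * n * C) <= _).
  rewrite ler_wpM2l //.
  apply: le_trans (_ : Ex (fun h s => C * (pair_dev h s ^+ 2 + (h + s))) <= _).
    apply: Ex_norm_le => h s h0 s0 hs; rewrite normrM mulrC ler_pM ?gC //.
    rewrite ler_norml; have := sqr_ge0 (pair_dev h s) => d0; apply/andP; split; lra.
  rewrite ExZ ExD mulrC ler_wpM2r //.
  have := Ex_pair_dev2 R _ N_gt0; have := Ex_k_le R N; lra.
have : bcoef R N * n * C <= 336 / 1000 * C by rewrite ler_wpM2r.
by lra.
Qed.

Lemma mean_dev : `|Ex dim_dev| <= 1.
Proof.
have := @Ex_remainder (fun=> 1) 1; have := stein_id R _ N_gt0 (fun=> 1).
have -> : Ex (fun h s => driftl R N h s * (1 - 1) + driftr R N h s * (1 - 1)) = 0.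
  by rewrite -[RHS](Ex_cst R N); apply: eq_Ex => h s _ _ _; rewrite subrr !mulr0 addr0.
rewrite add0r => <-; rewrite (_ : Ex (fun h s => dim_dev h s * 1) = Ex dim_dev).
  by apply => x; rewrite normr1.
by apply: eq_Ex => h s _ _ _; rewrite mulr1.
Qed.

Lemma Ex_drift :
  Ex (fun h s => `|driftl R N h s + 2 * driftr R N h s - var_rate R * n|) <= 5 * sqrt_size.
Proof.
apply: le_trans (_ : Ex (fun h s => 2 * `|pair_dev h s| + 2 * `|h - s| + 1) <= _).
  by apply: Ex_le => h s; apply: drift_le.
rewrite !ExD Ex_cst !ExZ.
have := Ex_pair_dev_norm; have := Ex_diff_norm; have := sqrt_size_ge1; lra.
Qed.

Lemma var_dev : `|Ex (fun h s => dim_dev h s ^+ 2) - var_rate R * n| <= 9 * sqrt_size.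
Proof.
have := stein_id R _ N_gt0 (fun x => x - 3 / 2 * pair_rate R * n).
rewrite (_ : Ex (fun h s => dim_dev h s * _) = Ex (fun h s => dim_dev h s ^+ 2)); last first.
  by apply: eq_Ex => h s _ _ _; rewrite expr2.
move=> ->.
(* The increments of the affine [g] are exactly [1] and [2], so [A] is the mean of the local
   variance. *)
set A := Ex _; have EA : `|A - var_rate R * n| <= 5 * sqrt_size.
  rewrite -[var_rate R * n](Ex_cst R N) -ExB; apply: le_trans (Ex_norm _ _ _) _.
  apply: le_trans Ex_drift; apply: Ex_le => h s _ _ _.
  by rewrite le_eqVlt; apply/orP; left; apply/eqP; congr `|_|; ring.
(* [Ex_remainder] does not cover this unbounded [g]. The product of [pair_dev ^+ 2] and [dim_dev] is
   split into the fourth moment of the one and the second moment of the other, weighted by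
   [sqrt_size]. *)
have EB : `|bcoef R N * Ex (fun h s => (pair_dev h s ^+ 2 - (h + s)) *
    (h + 2 * s - 3 / 2 * pair_rate R * n))| <= 4 * sqrt_size.
  have b0 := bcoef_ge0 R N; have /andP[_ b1] := bcoefn_bounds R _ N_gt0.
  have r0 := sqrt_size_gt0.
  rewrite normrM ger0_norm //.
  apply: le_trans (_ : bcoef R N * (9 * n * sqrt_size) <= _).
    rewrite ler_wpM2l //.
    apply: le_trans (_ : Ex (fun h s => 2^-1 * sqrt_size^-1 * pair_dev h s ^+ 4 +
      2^-1 * sqrt_size * dim_dev h s ^+ 2 + n * `|dim_dev h s|) <= _).
      apply: Ex_norm_le => h s h0 s0 hs; rewrite -/(dim_dev h s) normrM.
      apply: le_trans (_ : (pair_dev h s ^+ 2 + n) * `|dim_dev h s| <= _).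
        rewrite ler_wpM2r // ler_norml; have := sqr_ge0 (pair_dev h s) => d0.
        by apply/andP; split; lra.
      rewrite mulrDl lerD2r -(real_normK (num_real (dim_dev h s))).
      rewrite (exprM (pair_dev h s) 2 2); move: (pair_dev h s ^+ 2) (`|_|) => u v.
      have := sqr_ge0 (u - sqrt_size * v) => H; rewrite -(ler_pM2l r0).
      have -> : sqrt_size * (2^-1 / sqrt_size * u ^+ 2 + 2^-1 * sqrt_size * v ^+ 2) =
        (u ^+ 2 + (sqrt_size * v) ^+ 2) / 2 by field; apply: lt0r_neq0.
      by lra.
    rewrite !ExD !ExZ.
    have K1 : 2^-1 / sqrt_size * Ex (fun h s => pair_dev h s ^+ 4) <=
        2^-1 / sqrt_size * (5 * n ^+ 2).
      by rewrite ler_wpM2l ?Ex_pair_dev4 // mulr_ge0 ?invr_ge0 // ltW.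
    have K2 : 2^-1 * sqrt_size * Ex (fun h s => dim_dev h s ^+ 2) <= 2^-1 * sqrt_size * (5 * n).
      by apply: ler_wpM2l Ex_dim_dev2; rewrite mulr_ge0 ?invr_ge0 ?(ltW r0).
    have K3 : n * Ex (fun h s => `|dim_dev h s|) <= n * (3 * sqrt_size).
      by rewrite ler_wpM2l ?Ex_dim_dev_norm.
    have E : 2^-1 / sqrt_size * (5 * n ^+ 2) = 5 / 2 * (n * sqrt_size).
      by rewrite -sqrt_size_sq; field; apply: lt0r_neq0.
    have P : 0 <= n * sqrt_size by rewrite mulr_ge0 ?ler0n // ltW.
    by rewrite {}E in K1; lra.
  have : bcoef R N * n * sqrt_size <= 336 / 1000 * sqrt_size by rewrite ler_wpM2r // ltW.
  by lra.
move: EA EB; rewrite !ler_norml => /andP[? ?] /andP[? ?]; apply/andP; split; lra.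
Qed.

Definition class_mean : R := Ex (fun h s => h + 2 * s).
Definition class_var : R := Ex (fun h s => (h + 2 * s - class_mean) ^+ 2).

Lemma class_meanE : class_mean = 3 / 2 * pair_rate R * n + Ex dim_dev.
Proof.
rewrite -[3 / 2 * pair_rate R * n](Ex_cst R N) -ExD.
by apply: eq_Ex => h s _ _ _; rewrite /dim_dev; ring.
Qed.

Lemma class_varE : class_var = Ex (fun h s => dim_dev h s ^+ 2) - Ex dim_dev ^+ 2.
Proof.
have -> : class_var = Ex (fun h s =>
    dim_dev h s ^+ 2 - 2 * Ex dim_dev * dim_dev h s + Ex dim_dev ^+ 2).
  by apply: eq_Ex => h s _ _ _; rewrite class_meanE /dim_dev; ring.
by rewrite ExD Ex_cst ExB ExZ -/(Ex dim_dev); ring.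
Qed.

Lemma mean_le : `|class_mean - 3 / 2 * pair_rate R * n| <= 1.
Proof. by rewrite class_meanE addrC addKr mean_dev. Qed.

Lemma var_le : `|class_var - var_rate R * n| <= 10 * sqrt_size.
Proof.
have := var_dev; have := mean_dev; rewrite class_varE.
set e := Ex dim_dev; set v := Ex _ => E V.
have e2 : 0 <= e ^+ 2 <= 1 by rewrite sqr_ge0 -(real_normK (num_real e)) exprn_ile1.
have r1 := sqrt_size_ge1; move: V e2; rewrite !ler_norml => /andP[? ?] /andP[? ?].
by apply/andP; split; lra.
Qed.

End Estimates.

(** In the application [v] is the inverse standard deviation, [w] the modulus of the standardized
    dimension, [I] the window indicator, [x] and [y] the increments of [g] over steps [1] and [2],
    [p] the value of [f'], [l] and [d] the drifts, [B] the variance and [lam] its approximation. The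
    error consists of the two Taylor errors and the deviation of the local variance [l + 2 * d] from
    [B]. *)
Lemma stein_pointwise (R : realFieldType) (n v C w I l d x y p lam B r : R) :
  0 <= n -> 0 <= v -> 0 <= C -> 0 <= w -> 0 <= I ->
  `|x - v * p| <= C * v ^+ 2 * (1 + w) + 2 * C * v * I ->
  `|y - 2 * v * p| <= 4 * C * v ^+ 2 * (1 + w) + 4 * C * v * I ->
  `|p| <= C -> `|l| <= n -> `|d| <= 2 * n -> `|B - lam| <= r ->
  `|B * v * p - (l * x + d * y)| <= 9 * (n * v ^+ 2) * C * (w + 1) +
     10 * (n * v) * C * I + v * C * (`|l + 2 * d - lam| + r).
Proof.
move=> n0 v0 C0 w0 I0 hx hy hp hl hd hB.
have -> : B * v * p - (l * x + d * y) = - (l * (x - v * p)) - d * (y - 2 * v * p) -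
  v * p * ((l + 2 * d - lam) - (B - lam)) by ring.
have P1 : `|l * (x - v * p)| <= n * (C * v ^+ 2 * (1 + w) + 2 * C * v * I).
  by rewrite normrM ler_pM.
have P2 : `|d * (y - 2 * v * p)| <= 2 * n * (4 * C * v ^+ 2 * (1 + w) + 4 * C * v * I).
  by rewrite normrM ler_pM.
have P3 : `|v * p * ((l + 2 * d - lam) - (B - lam))| <= v * C * (`|l + 2 * d - lam| + r).
  rewrite !normrM (ger0_norm v0) ler_pM ?mulr_ge0 ?ler_wpM2l //.
  by apply: le_trans (ler_normB _ _) _; rewrite lerD2l.
apply: le_trans (ler_normB _ _) _.
have := ler_normB (- (l * (x - v * p))) (d * (y - 2 * v * p)); rewrite normrN.
by move: P1 P2 P3 => P1 P2 P3 P4; lra.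
Qed.

(** With [x <= y <= z] the values of the ramp at [X - 2], [X - 1] and [X], the right side is
    [(l + d) (z - y) + d (y - x)]. Only [d] and the sum [l + d] need lower bounds, which matters as
    [l] may be negative. *)
Lemma drift_window_le (R : realFieldType) (n l d t u x y z : R) (I : bool) :
  0 <= n -> 0 <= t -> 0 <= u -> x <= y -> y <= z -> 0 <= d -> (I -> z - y = 1) ->
  z - y <= 1 -> 19 / 100 * n - t - u <= l + d ->
  19 / 100 * n * I%:R - (t + u) <= l * (z - y) + d * (z - x).
Proof.
move=> n0 t0 u0 xy yz d0 H' w H.
have K1 : 0 <= d * (y - x) by rewrite mulr_ge0 // subr_ge0.
have K2 : (19 / 100 * n - t - u) * (z - y) <= (l + d) * (z - y).
  by rewrite ler_wpM2r // subr_ge0.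
case: I H' => H'.
  have {}H' := H' isT; have E : z = y + 1 by lra.
  by rewrite {}E in K2 *; rewrite /= mulr1; lra.
have K3 : (t + u) * (z - y) <= (t + u) * 1 by rewrite ler_wpM2l // addr_ge0.
have K4 : 0 <= n * (z - y) by rewrite mulr_ge0 // subr_ge0.
rewrite mulr0; lra.
Qed.

(** * Normal approximation by Stein's method *)

Section NormalApproximation.
Variables (R : rcfType) (N : nat).
Hypothesis N_gt0 : (0 < N)%N.
Notation n := (N%:R : R).
Notation Ex := (Ex R N).
Notation pair_dev := (pair_dev R N).
Notation dim_dev := (dim_dev R N).
Notation sqrt_size := (sqrt_size R N).
Notation class_mean := (class_mean R N).
Notation class_var := (class_var R N).

(* Slope [1] from [A - 1] to [A + 2], so that the increment over a step of length
   [1] ending in the window ]A, A + 2] is exactly [1]. *)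
Definition ramp (A x : R) : R :=
  if x <= A - 1 then - (3 / 2) else if x <= A + 2 then x - A - 2^-1 else 3 / 2.

Lemma ramp_le A x : `|ramp A x| <= 3 / 2.
Proof.
rewrite /ramp ler_norml; case: (lerP x (A - 1)) => H1; first by apply/andP; split; lra.
by case: (lerP x (A + 2)) => H2; apply/andP; split; lra.
Qed.

Lemma ramp_nondecreasing A x y : x <= y -> ramp A x <= ramp A y.
Proof.
move=> xy; rewrite /ramp.
by case: (lerP x (A - 1)) => H1; case: (lerP y (A - 1)) => H2;
  case: (lerP x (A + 2)) => H3; case: (lerP y (A + 2)) => H4; lra.
Qed.

Lemma ramp_step A x : ramp A x - ramp A (x - 1) <= 1.
Proof.
rewrite /ramp.
by case: (lerP x (A - 1)) => H1; case: (lerP (x - 1) (A - 1)) => H2;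
  case: (lerP x (A + 2)) => H3; case: (lerP (x - 1) (A + 2)) => H4; lra.
Qed.

Lemma ramp_window A x : A < x <= A + 2 -> ramp A x - ramp A (x - 1) = 1.
Proof.
move=> /andP[Ax xA]; rewrite /ramp.
by case: (lerP x (A - 1)) => H1; case: (lerP (x - 1) (A - 1)) => H2;
  case: (lerP x (A + 2)) => H3; case: (lerP (x - 1) (A + 2)) => H4; lra.
Qed.

(** Its length is that of the longest step of the dimension. *)
Definition window (A x : R) : R := (A < x <= A + 2)%R%:R.

(** The terms [h / 2] and [s / 2] cancel up to the deviation [h - s]. What remains is about
    [bcoef * (h + s) ^+ 2], which at the centre is at least [0.193 n]. *)
Lemma drift_sum_ge h s : 0 <= h -> 0 <= s -> h + s <= n ->
  19 / 100 * n - `|pair_dev h s| - `|h - s| <= driftl R N h s + driftr R N h s.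
Proof.
move=> h0 s0 hs; have b0 := bcoef_ge0 R N; have /andP[B1 B2] := bcoefn_bounds R _ N_gt0.
have /andP[c1 c2] := pair_rate_bounds R.
have -> : driftl R N h s + driftr R N h s =
  bcoef R N * (h + s) ^+ 2 + bcoef R N * (h + s) - (h - s) / 2.
  by rewrite /driftl /driftr; field.
have A1 : 0 <= bcoef R N * (h + s) by rewrite mulr_ge0 // addr_ge0.
have A2 : bcoef R N * n * pair_rate R ^+ 2 * n + 2 * (bcoef R N * n) * pair_rate R * pair_dev h s <=
    bcoef R N * (h + s) ^+ 2.
  have : 0 <= bcoef R N * pair_dev h s ^+ 2 by rewrite mulr_ge0 // sqr_ge0.
  by rewrite /pair_dev; lra.
have A3 : 193 / 1000 * n <= bcoef R N * n * pair_rate R ^+ 2 * n.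
  rewrite ler_wpM2r ?ler0n // pair_rate_eq.
  apply: le_trans (_ : 335 / 1000 * (6 * pair_rate R - 4) <= _); first by lra.
  by rewrite ler_wpM2r //; lra.
have A4 : `|2 * (bcoef R N * n) * pair_rate R * pair_dev h s| <= `|pair_dev h s|.
  have BC : 0 <= bcoef R N * n * pair_rate R by apply: mulr_ge0; lra.
  rewrite normrM -[leRHS]mul1r ler_wpM2r // ger0_norm; last by lra.
  have : bcoef R N * n * pair_rate R <= 336 / 1000 * pair_rate R by rewrite ler_wpM2r //; lra.
  by lra.
have := ler_norm (h - s); have n0 := ler0n R N.
move: A4; rewrite ler_norml => /andP[? ?] ?; have := normr_ge0 (h - s); lra.
Qed.

(** In [stein_id] for the ramp the left side is at most [9/2 sqrt_size], while the increments
    contribute at least [0.19 n] times the window probability, up to [2 sqrt_size]. With the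
    remainder [3/2] this gives [8 / 0.19 < 50]. *)
Lemma concentration A :
  sqrt_size * Ex (fun h s => window A (h + 2 * s)) <= 50.
Proof.
have r1 := sqrt_size_ge1 R _ N_gt0.
have := stein_id R _ N_gt0 (ramp A); set S := Ex _ => ES.
have S_le : S <= 9 / 2 * sqrt_size.
  apply: le_trans (_ : Ex (fun h s => 3 / 2 * `|dim_dev h s|) <= _).
    apply: Ex_le => h s _ _ _; apply: le_trans (ler_norm _) _.
    by rewrite normrM mulrC ler_wpM2r // ramp_le.
  by rewrite ExZ; have := Ex_dim_dev_norm R _ N_gt0; lra.
have := Ex_remainder R _ N_gt0 (ramp A) (3 / 2) (ramp_le A).
rewrite {}ES in S_le; set r := bcoef R N * _ in S_le *.
rewrite ler_norml => /andP[r_ge r_le]; move: S_le; set D := Ex _ => S_le.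
set P := Ex _.
have D_ge : 19 / 100 * n * P - 2 * sqrt_size <= D.
  apply: le_trans (_ : Ex (fun h s => 19 / 100 * n * window A (h + 2 * s)
    - (`|pair_dev h s| + `|h - s|)) <= _).
    rewrite ExB ExZ ExD -/P.
    by have := Ex_pair_dev_norm R _ N_gt0; have := Ex_diff_norm R _ N_gt0; lra.
  apply: Ex_le => h s h0 s0 hs; have := drift_sum_ge h s h0 s0 hs.
  have dr0 : 0 <= driftr R N h s.
    have /andP[bk _] := bcoef_k R _ N_gt0 h s h0 s0 hs.
    exact: addr_ge0 (mulr_ge0 bk s0) (divr_ge0 s0 (ler0n _ 2)).
  have H2 := ramp_step A (h + 2 * s); have H3 := ramp_window A (h + 2 * s).
  have M1 := ramp_nondecreasing A (h + 2 * s - 1) (h + 2 * s) ltac:(lra).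
  have M2 := ramp_nondecreasing A (h + 2 * s - 2) (h + 2 * s - 1) ltac:(lra).
  by move=> H; apply: drift_window_le => //; exact: ler0n.
have : sqrt_size * (sqrt_size * P * (19 / 100)) <= sqrt_size * 8.
  by rewrite -(sqrt_size_sq R N) in D_ge; lra.
by rewrite ler_pM2l; lra.
Qed.

(** What is required of a solution of the Stein equation: the Taylor estimate is demanded only of
    steps from [x - u] to [x] that do not pass the jump [a] of [f']. *)
Variables (f f' : R -> R) (a C : R).
Hypothesis f_le : forall x, `|f x| <= C.
Hypothesis f'_le : forall x, `|f' x| <= C.
Hypothesis f_lip : forall x u, 0 <= u -> `|f x - f (x - u)| <= C * u.
Hypothesis f_taylor : forall x u, 0 <= u -> ~~ (a < x <= a + u) ->
  `|f x - f (x - u) - u * f' x| <= C * u ^+ 2 * (1 + `|x|).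

Definition std_dim (h s : R) : R := (h + 2 * s - class_mean) / Num.sqrt class_var.

(** [stein_id] is applied to [f] after standardization. With [v] the inverse standard deviation, the
    Taylor error of a step is of order [v^2] off the window and [v] on it, and the window has
    probability of order [1 / sqrt_size]. The assumed variance bound makes [v] at most
    [2 / sqrt_size]. *)
Lemma stein_bound : n / 4 <= class_var ->
  sqrt_size * `|Ex (fun h s => f' (std_dim h s) - std_dim h s * f (std_dim h s))| <= 2300 * C.
Proof.
move=> var_ge.
have C0 : 0 <= C := le_trans (normr_ge0 _) (f_le 0).
have r1 := sqrt_size_ge1 R _ N_gt0; have n1 := n_ge1 R _ N_gt0; have rr := sqrt_size_sq R N.
have var0 : 0 < class_var by lra.
pose v := (Num.sqrt class_var)^-1.
have s0 : 0 < Num.sqrt class_var by rewrite sqrtr_gt0.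
have v0 : 0 < v by rewrite invr_gt0.
have v2 : class_var * v ^+ 2 = 1.
  by rewrite /v exprVn sqr_sqrtr ?(ltW var0) // divff // lt0r_neq0.
have nv2 : n * v ^+ 2 <= 4.
  have : n * v ^+ 2 <= 4 * class_var * v ^+ 2 by rewrite ler_wpM2r ?sqr_ge0 //; lra.
  by rewrite -mulrA v2; lra.
have rho0 : 0 <= sqrt_size by lra.
have rv : sqrt_size * v <= 2.
  rewrite -(ler_pXn2r (ltn0Sn 1)) ?nnegrE ?ler0n //; last by rewrite mulr_ge0 // ltW.
  by rewrite exprMn [sqrt_size ^+ 2]expr2 rr; lra.
have nv : n * v <= 2 * sqrt_size.
  by rewrite -rr -mulrA mulrC ler_wpM2r.
have WE h s : std_dim h s = v * (h + 2 * s - class_mean) by rewrite mulrC.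
pose g x := f (v * (x - class_mean)).
have gW h s : g (h + 2 * s) = f (std_dim h s) by rewrite WE.
pose I h s : R := window (class_mean + a * Num.sqrt class_var) (h + 2 * s).
have II h s u : 0 <= u <= 2 -> a < std_dim h s <= a + u * v -> I h s = 1.
  move=> /andP[u0 u2]; rewrite WE => /andP[W1 W2].
  have sv : Num.sqrt class_var * v = 1 by rewrite mulfV // lt0r_neq0.
  rewrite -(ltr_pM2l s0) mulrA sv mul1r in W1.
  rewrite -(ler_pM2l s0) mulrA sv mul1r mulrDr (mulrC u) mulrA sv mul1r in W2.
  rewrite /I /window; suff -> : class_mean + a * Num.sqrt class_var < h + 2 * s <=
    class_mean + a * Num.sqrt class_var + 2 by [].
  by apply/andP; split; lra.
have DE h s u : 0 <= u <= 2 ->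
    `|f (std_dim h s) - f (std_dim h s - u * v) - u * v * f' (std_dim h s)| <=
    C * (u * v) ^+ 2 * (1 + `|std_dim h s|) + 2 * C * (u * v) * I h s.
  move=> u02; have /andP[u0 _] := u02; have uv : 0 <= u * v by rewrite mulr_ge0 // ltW.
  have P : 0 <= C * (u * v) ^+ 2 * (1 + `|std_dim h s|).
    exact: mulr_ge0 (mulr_ge0 C0 (sqr_ge0 _)) (addr_ge0 ler01 (normr_ge0 _)).
  have P' : 0 <= 2 * C * (u * v) := mulr_ge0 (mulr_ge0 (ler0n _ 2) C0) uv.
  have [bad|good] := boolP (a < std_dim h s <= a + u * v).
    rewrite (II _ _ _ u02 bad) mulr1.
    apply: le_trans (ler_normB _ _) _; rewrite normrM (ger0_norm uv).
    have := f_lip (std_dim h s) _ uv.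
    have : u * v * `|f' (std_dim h s)| <= u * v * C by rewrite ler_wpM2l.
    by lra.
  apply: le_trans (f_taylor _ _ uv good) _; rewrite lerDl; exact: mulr_ge0 P' (ler0n _ _).
pose D1 h s := g (h + 2 * s) - g (h + 2 * s - 1).
pose D2 h s := g (h + 2 * s) - g (h + 2 * s - 2).
have D1E h s : `|D1 h s - v * f' (std_dim h s)| <=
    C * v ^+ 2 * (1 + `|std_dim h s|) + 2 * C * v * I h s.
  have := DE h s 1 ltac:(apply/andP; split; lra); rewrite mul1r -gW /D1 /g.
  rewrite WE.
  by have -> : v * (h + 2 * s - class_mean) - v =
    v * (h + 2 * s - 1 - class_mean) by ring.
have D2E h s : `|D2 h s - 2 * v * f' (std_dim h s)| <=
    4 * C * v ^+ 2 * (1 + `|std_dim h s|) + 4 * C * v * I h s.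
  have := DE h s 2 ltac:(apply/andP; split; lra); rewrite -gW /D2 /g.
  rewrite WE; have -> : v * (h + 2 * s - class_mean) - 2 * v =
    v * (h + 2 * s - 2 - class_mean) by ring.
  by rewrite exprMn; lra.
have EW : Ex (fun h s => `|std_dim h s|) <= 1.
  apply: le_trans (_ : Ex (fun h s => 2^-1 * (v ^+ 2 * (h + 2 * s - class_mean) ^+ 2) + 2^-1) <= _).
    apply: Ex_le => h s _ _ _; rewrite -exprMn -WE -(real_normK (num_real (std_dim h s))).
    by move: `|_| => w; have := sqr_ge0 (w - 1); lra.
  by rewrite ExD Ex_cst !ExZ -/class_var mulrC; have := v2; lra.
(* [K] is the Stein expression times the standard deviation. Its last term corrects for [dim_dev]
   being centred at [3/2 pair_rate n] and not at [class_mean]. *)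
pose K := Ex (fun h s => class_var * v * f' (std_dim h s))
  - Ex (fun h s => dim_dev h s * g (h + 2 * s))
  + Ex dim_dev * Ex (fun h s => g (h + 2 * s)).
have -> : Ex (fun h s => f' (std_dim h s) - std_dim h s * f (std_dim h s)) = v * K.
  rewrite /K -ExZ -ExB -ExD -ExZ; apply: eq_Ex => h s _ _ _.
  rewrite gW; move: (f _) (f' _) => p q; rewrite WE (class_meanE R N) /dim_dev.
  by rewrite -{1}(mul1r q) -{1}v2; ring.
(* The constant is [72 + 1000 + 30] from Taylor errors, window and variance, plus [1] each for the
   remainder and the change of centre. *)
have Kle : `|K| <= 1104 * C.
  have R1 := Ex_remainder R _ N_gt0 g C (fun x => f_le _).
  have M1 : `|Ex dim_dev * Ex (fun h s => g (h + 2 * s))| <= C.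
    rewrite normrM -[leRHS]mul1r ler_pM ?mean_dev //.
    by rewrite -[leRHS](Ex_cst R N); apply: Ex_norm_le => h s _ _ _; exact: f_le.
  have M2 : `|Ex (fun h s => class_var * v * f' (std_dim h s)) -
      Ex (fun h s => driftl R N h s * D1 h s + driftr R N h s * D2 h s)| <= 1102 * C.
    rewrite -ExB.
    apply: le_trans (_ : Ex (fun h s => 9 * (n * v ^+ 2) * C * (`|std_dim h s| + 1) +
      10 * (n * v) * C * I h s + v * C *
      (`|driftl R N h s + 2 * driftr R N h s - var_rate R * n| + 10 * sqrt_size)) <= _).
      apply: Ex_norm_le => h s h0 s0' hs.
      have L1 := driftl_le R _ N_gt0 h s h0 s0' hs.
      have L2 := driftr_le R _ N_gt0 h s h0 s0' hs.
      have V := var_le R _ N_gt0.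
      move: (D1E h s) (D2E h s) (f'_le (std_dim h s)) L1 L2 V.
      exact: stein_pointwise (ler0n _ _) (ltW v0) C0 (normr_ge0 _) (ler0n _ _).
    rewrite !ExD !ExZ !ExD !Ex_cst.
    have Q1 : 9 * (n * v ^+ 2) * C * (Ex (fun h s => `|std_dim h s|) + 1) <= 9 * 4 * C * (1 + 1).
      apply: ler_pM.
      - exact: mulr_ge0 (mulr_ge0 (ler0n _ 9) (mulr_ge0 (ler0n _ N) (sqr_ge0 v))) C0.
      - by apply: addr_ge0 ler01; rewrite -[leLHS](Ex_cst R N); apply: Ex_le.
      - exact: ler_wpM2r C0 _ _ (ler_wpM2l (ler0n _ 9) nv2).
      - by rewrite lerD2r.
    have conc := concentration (class_mean + a * Num.sqrt class_var); rewrite -/(Ex I) in conc.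
    have Q2 : 10 * (n * v) * C * Ex I <= 1000 * C.
      have : n * v * (C * Ex I) <= 2 * sqrt_size * (C * Ex I).
        rewrite ler_wpM2r // mulr_ge0 // -[leLHS](Ex_cst R N).
        by apply: Ex_le => h s _ _ _; exact: ler0n.
      have : C * (sqrt_size * Ex I) <= C * 50 by rewrite ler_wpM2l.
      by lra.
    have Q3 : v * C * (Ex (fun h s =>
       `|driftl R N h s + 2 * driftr R N h s - var_rate R * n|) + 10 * sqrt_size) <= 30 * C.
      have : v * C * (Ex (fun h s =>
        `|driftl R N h s + 2 * driftr R N h s - var_rate R * n|) + 10 * sqrt_size) <=
        v * C * (15 * sqrt_size).
        apply: ler_wpM2l (mulr_ge0 (ltW v0) C0) _ _ _.
        by have := Ex_drift R _ N_gt0; lra.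
      have : C * (sqrt_size * v) <= C * 2 by rewrite ler_wpM2l.
      by lra.
    by lra.
  have KE : K = (Ex (fun h s => class_var * v * f' (std_dim h s)) -
      Ex (fun h s => driftl R N h s * D1 h s + driftr R N h s * D2 h s)) -
      bcoef R N * Ex (fun h s => (pair_dev h s ^+ 2 - (h + s)) * g (h + 2 * s)) +
      Ex dim_dev * Ex (fun h s => g (h + 2 * s)).
    by rewrite /K (stein_id R _ N_gt0 g) opprD addrA.
  rewrite KE; apply: le_trans (ler_normD _ _) _.
  by have := ler_normB (Ex (fun h s => class_var * v * f' (std_dim h s)) -
      Ex (fun h s => driftl R N h s * D1 h s + driftr R N h s * D2 h s))
      (bcoef R N * Ex (fun h s => (pair_dev h s ^+ 2 - (h + s)) * g (h + 2 * s))); lra.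
rewrite normrM (ger0_norm (ltW v0)) mulrA.
have : sqrt_size * v * `|K| <= 2 * (1104 * C).
  by apply: ler_pM => //; rewrite mulr_ge0 ?(ltW v0) //; lra.
by lra.
Qed.

End NormalApproximation.

Local Open Scope classical_set_scope.
Local Open Scope ring_scope.

(** * The normal distribution function and the Stein equation *)

(** As a random variable under the normal law, the identity has [normal_cdf] as its distribution
    function, so the general limits of [cdf] apply. *)
Definition line_id (R : realType) : measurableTypeR R -> R := idfun.

HB.instance Definition _ (R : realType) :=
  @isMeasurableFun.Build _ _ _ _ (line_id R) (@measurable_id _ _ setT).

Section NormalCdf.
Variable R : realType.
Implicit Types x y a : R.

Definition normal_density x : R := normal_pdf 0 1 x.
Definition normal_cdf x : R := fine (normal_prob 0 1 `]-oo, x]).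

Lemma normal_densityE x : normal_density x = normal_peak 1 * expR (- x ^+ 2 / 2).
Proof.
by rewrite /normal_density normal_pdfE ?oner_neq0 // /normal_fun subr0 expr1n.
Qed.

Lemma normal_density_gt0 x : 0 < normal_density x.
Proof. by rewrite normal_densityE mulr_gt0 ?expR_gt0 ?normal_peak_gt0 ?oner_neq0. Qed.

Lemma normal_density_ge x y : `|x| <= y -> normal_density y <= normal_density x.
Proof.
move=> xy; rewrite !normal_densityE ler_pM2l ?normal_peak_gt0 ?oner_neq0 // ler_expR.
rewrite !mulNr lerN2 ler_pM2r ?invr_gt0 // -(real_normK (num_real x)).
by rewrite ler_pXn2r // nnegrE // (le_trans _ xy).
Qed.

Lemma is_derive_normal_density x : is_derive x 1 normal_density (- (x * normal_density x)).
Proof.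
have -> : normal_density = fun x => normal_peak 1 * expR (- x ^+ 2 / 2).
  by apply/funext => y; exact: normal_densityE.
have D : is_derive x 1 (fun y : R => - y ^+ 2 / 2) (- x).
  by apply: is_derive_eq; rewrite /GRing.scale /=; field.
have E : is_derive x 1 (fun y => expR (- y ^+ 2 / 2)) (- x * expR (- x ^+ 2 / 2)).
  by rewrite mulrC; exact: (is_derive1_comp (f := expR)).
by apply: is_derive_eq; rewrite /GRing.scale /=; ring.
Qed.

Lemma is_derive_normal_cdf x : is_derive x 1 normal_cdf (normal_density x).
Proof.
have := @continuous_FTC1 R (normal_pdf 0 1) -oo%O x (x + 1).
rewrite ltrDl ltr01 ltNyr => /(_ isT) H.
have [|//||D E] := H.
- by apply: (integrableS _ _ (@subsetT _ _)) => //; exact: integrable_normal_pdf.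
- exact: continuous_normal_pdf (oner_neq0 _) x.
apply: DeriveDef D _; by rewrite -derive1E E.
Qed.

Lemma normal_cdf_fin x : (normal_cdf x)%:E = normal_prob 0 1 `]-oo, x].
Proof. by rewrite /normal_cdf fineK // fin_num_measure. Qed.

Lemma normal_cdf_ge0 x : 0 <= normal_cdf x.
Proof. by rewrite /normal_cdf fine_ge0. Qed.

Lemma normal_cdf_le1 x : normal_cdf x <= 1.
Proof. by rewrite -lee_fin normal_cdf_fin probability_le1. Qed.

Lemma normal_cdf_cvgy : normal_cdf x @[x --> +oo] --> (1 : R).
Proof.
have := cvg_cdfy1 (P := normal_prob (0 : R) 1) (line_id R : {RV normal_prob (0 : R) 1 >-> R}).
by move=> /fine_cvgP[_].
Qed.

Lemma normal_cdf_cvgNy : normal_cdf x @[x --> -oo] --> (0 : R).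
Proof.
have := cvg_cdfNy0 (P := normal_prob (0 : R) 1) (line_id R : {RV normal_prob (0 : R) 1 >-> R}).
by move=> /fine_cvgP[_].
Qed.

Lemma is_derive_nondecreasing (g dg : R -> R) x y : x <= y ->
  (forall z, x <= z <= y -> is_derive z 1 g (dg z)) ->
  (forall z, x <= z <= y -> 0 <= dg z) -> g x <= g y.
Proof.
move=> xy Dg dg0.
have [||c cxy E] := @MVT_segment R g dg x y xy.
- move=> z; rewrite in_itv /= => /andP[xz zy]; apply: Dg; by rewrite !ltW.
- apply: derivable_within_continuous => z; rewrite in_itv /= => zxy.
  by have [] := Dg z zxy.
by rewrite -subr_ge0 E mulr_ge0 ?subr_ge0 // dg0.
Qed.

(* [normal_density x / x - (1 - normal_cdf x)] decreases to [0] on ]0, +oo[. *)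
Lemma mills_right x : 0 < x -> x * (1 - normal_cdf x) <= normal_density x.
Proof.
move=> x0; rewrite mulrC -ler_pdivlMr //.
apply/ler_addgt0Pl => e e0.
have /cvgrPdist_lt /(_ e e0) [M [_ HM]] := normal_cdf_cvgy.
pose y := Num.max x (M + 1).
have xy : x <= y by rewrite le_max lexx.
have My : M < y by rewrite lt_max orbC ltrDl ltr01.
have {HM My} Ny : 1 - normal_cdf y < e.
  by have := HM y My; apply: le_lt_trans; exact: ler_norm.
suff : - (normal_density x / x) + (1 - normal_cdf x) <=
    - (normal_density y / y) + (1 - normal_cdf y).
  have : 0 <= normal_density y / y by rewrite divr_ge0 ?ltW ?normal_density_gt0 // (lt_le_trans x0).
  by lra.
apply: (is_derive_nondecreasing (fun z => - (normal_density z / z) + (1 - normal_cdf z))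
  (fun z => normal_density z / z ^+ 2)) => // z /andP[xz _].
  have z0 : z != 0 by rewrite gt_eqF // (lt_le_trans x0).
  have D1 := is_derive_normal_density z; have D2 := is_derive_normal_cdf z.
  have D3 : is_derive z 1 (fun y : R => y^-1) (- z ^- 2 *: 1) := is_deriveV z0 (is_derive_id z 1).
  apply: is_derive_eq; rewrite /GRing.scale /=; field.
  exact: z0.
by rewrite divr_ge0 ?sqr_ge0 // ltW // normal_density_gt0.
Qed.

Lemma mills_left x : x < 0 -> - x * normal_cdf x <= normal_density x.
Proof.
move=> x0; rewrite mulrC -ler_pdivlMr ?oppr_gt0 //.
apply/ler_addgt0Pl => e e0.
have /cvgrPdist_lt /(_ e e0) [M [_ HM]] := normal_cdf_cvgNy.
pose y := Num.min x (M - 1).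
have yx : y <= x by rewrite ge_min lexx.
have My : y < M by rewrite gt_min orbC ltrBlDr ltrDl ltr01.
have {HM My} Ny : normal_cdf y < e.
  by have := HM y My; rewrite sub0r normrN; apply: le_lt_trans; exact: ler_norm.
have y0 : y < 0 := le_lt_trans yx x0.
suff : normal_density y / - y - normal_cdf y <= normal_density x / - x - normal_cdf x.
  have : 0 <= normal_density y / - y by rewrite divr_ge0 ?ltW ?normal_density_gt0 // oppr_gt0.
  by lra.
apply: (is_derive_nondecreasing (fun z => normal_density z / - z - normal_cdf z)
  (fun z => normal_density z / z ^+ 2)) => // z /andP[_ zx].
  have z0 : z != 0 by rewrite lt_eqF // (le_lt_trans zx).
  have D1 := is_derive_normal_density z; have D2 := is_derive_normal_cdf z.
  have Nz0 : - z != 0 by rewrite oppr_eq0.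
  have DN : is_derive z 1 (fun y : R => - y) (- 1) by apply: is_derive_eq.
  have D3 : is_derive z 1 (fun y : R => (- y)^-1) (- (- z) ^- 2 *: - 1) := is_deriveV Nz0 DN.
  apply: is_derive_eq; rewrite /GRing.scale /=; field.
  exact: z0.
by rewrite divr_ge0 ?sqr_ge0 // ltW // normal_density_gt0.
Qed.

End NormalCdf.

(** * Bounds and regularity of the bounded Stein solution *)

Section SteinSolution.
Variable R : realType.
Implicit Types x y z a u : R.

(* On an interval where [phi' = z phi + e], the derivative is Lipschitz up to
   the factor [1 + |x|]. *)
Lemma branch_estimates (phi : R -> R) (e C : R) x y : y <= x ->
  (forall z, is_derive z 1 phi (z * phi z + e)) ->
  (forall z, y <= z <= x -> `|phi z| <= C /\ `|z * phi z + e| <= C) ->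
  `|phi x - phi y| <= C * (x - y) /\
  `|phi x - phi y - (x - y) * (x * phi x + e)| <= C * (x - y) ^+ 2 * (1 + `|x|).
Proof.
move=> yx D B.
have lip w z : y <= w -> w <= z -> z <= x ->
    exists2 t, w <= t <= z & phi z - phi w = (z - w) * (t * phi t + e).
  move=> yw wz zx; have [|t twz E] := @MVT_segment R phi (fun z => z * phi z + e) w z wz.
    by apply: derivable_within_continuous => t _; have [] := D t.
  by exists t; [move: twz; rewrite in_itv | rewrite mulrC].
have lipn w z : y <= w -> w <= z -> z <= x -> `|phi z - phi w| <= C * (z - w).
  move=> yw wz zx; have [t /andP[wt tz] ->] := lip w z yw wz zx.
  rewrite normrM ger0_norm ?subr_ge0 // mulrC ler_wpM2r ?subr_ge0 //.
  by have [|_ +] := B t; first by rewrite (le_trans yw wt) (le_trans tz zx).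
split; first exact: lipn.
have [t /andP[yt tx] ->] := lip y x (lexx y) yx (lexx x).
have [|Bt _] := B t; first by rewrite yt tx.
have -> : (x - y) * (t * phi t + e) - (x - y) * (x * phi x + e) =
  - ((x - y) * (x * (phi x - phi t) + (x - t) * phi t)) by ring.
rewrite normrN normrM ger0_norm ?subr_ge0 //.
have -> : C * (x - y) ^+ 2 * (1 + `|x|) =
  (x - y) * (`|x| * (C * (x - y)) + (x - y) * C) by ring.
rewrite ler_wpM2l ?subr_ge0 //; apply: le_trans (ler_normD _ _) _.
have C0 : 0 <= C := le_trans (normr_ge0 _) Bt.
rewrite !normrM lerD //.
  rewrite ler_wpM2l //; apply: le_trans (lipn t x yt tx (lexx x)) _.
  by rewrite ler_wpM2l // lerB.
by rewrite ler_pM // ger0_norm ?subr_ge0 // lerB.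
Qed.

(** Mills ratios: they solve [phi' = z phi + e] with [e = 1] and [e = - 1], the left one staying
    bounded towards [-oo] and the right one towards [+oo]. *)
Definition stein_left x : R := normal_cdf R x / normal_density R x.
Definition stein_right x : R := (1 - normal_cdf R x) / normal_density R x.

Lemma is_derive_inv_normal_density x :
  is_derive x 1 (fun z => (normal_density R z)^-1) (x * (normal_density R x)^-1).
Proof.
have p0 : normal_density R x != 0 by rewrite gt_eqF // normal_density_gt0.
have D := is_derive_normal_density R x.
have := is_deriveV p0 D => D'; apply: (is_derive_eq D').
by rewrite /GRing.scale /=; field; exact: p0.
Qed.

Lemma is_derive_stein_left x : is_derive x 1 stein_left (x * stein_left x + 1).
Proof.
have p0 : normal_density R x != 0 by rewrite gt_eqF // normal_density_gt0.
have D1 := is_derive_inv_normal_density x; have D2 := is_derive_normal_cdf R x.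
rewrite /stein_left; apply: is_derive_eq; rewrite /GRing.scale /=; field.
exact: p0.
Qed.

Lemma is_derive_stein_right x : is_derive x 1 stein_right (x * stein_right x - 1).
Proof.
have p0 : normal_density R x != 0 by rewrite gt_eqF // normal_density_gt0.
have D1 := is_derive_inv_normal_density x; have D2 := is_derive_normal_cdf R x.
rewrite /stein_right; apply: is_derive_eq; rewrite /GRing.scale /=; field.
exact: p0.
Qed.

Variable a : R.
Let w : R := normal_cdf R a.

(* The bounded solution of [f' x - x f x = (x <= a) - normal_cdf a]; at the jump
   [a], [stein_der] is its left derivative. *)
Definition stein_sol x : R :=
  if x <= a then (1 - w) * stein_left x else w * stein_right x.
Definition stein_der x : R := x * stein_sol x + (x <= a)%R%:R - w.
Definition stein_const : R := 2 + (`|a| + 1) / normal_density R (`|a| + 1).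

(** For [|x| <= |a| + 1] the density is at least its value at [|a| + 1]. Farther out, [x <= a]
    forces [x < - 1] and [a < x] forces [1 < x], where the Mills bounds apply. The unit left below
    [stein_const] is spent on the jump term of [stein_der]. *)
Lemma stein_sol_bounds x :
  `|stein_sol x| <= stein_const - 1 /\ `|x * stein_sol x| <= stein_const - 1.
Proof.
have w0 : 0 <= w := normal_cdf_ge0 R a; have w1 : w <= 1 := normal_cdf_le1 R a.
set M : R := `|a| + 1; have M1 : 1 <= M by rewrite lerDr.
have pM := normal_density_gt0 R M; have px := normal_density_gt0 R x.
have -> : stein_const - 1 = 1 + M / normal_density R M by rewrite /stein_const -/M; ring.
have MpM : 0 <= M / normal_density R M by rewrite divr_ge0 ?(ltW pM) // (le_trans ler01).
suff : `|stein_sol x| <= 1 /\ `|x * stein_sol x| <= 1 \/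
    `|stein_sol x| <= M / normal_density R M /\ `|x * stein_sol x| <= M / normal_density R M.
  by case=> -[H1 H2]; split; lra.
have near b c : `|x| <= M -> 0 <= b <= 1 -> 0 <= c <= 1 ->
    `|b * (c / normal_density R x)| <= M / normal_density R M /\
    `|x * (b * (c / normal_density R x))| <= M / normal_density R M.
  move=> xM /andP[b0 b1] /andP[c0 c1]; have pMx := normal_density_ge R x M xM.
  have K : `|b * (c / normal_density R x)| <= (normal_density R M)^-1.
    rewrite mulrA normrM (ger0_norm (mulr_ge0 b0 c0)) (ger0_norm (ltW _)) ?invr_gt0 //.
    rewrite -[leRHS]mul1r ler_pM ?mulr_ge0 ?invr_ge0 ?(ltW px) ?lef_pV2 //.
    by rewrite -[leRHS]mul1r ler_pM.
  split; last by rewrite normrM ler_pM.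
  by apply: le_trans K _; rewrite ler_peMl ?invr_ge0 ?(ltW pM).
have small b c : 0 <= b <= 1 -> `|c| <= 1 -> `|b * c| <= 1.
  by move=> /andP[b0 b1] c1; rewrite normrM (ger0_norm b0) mulr_ile1.
have F0 := normal_cdf_ge0 R x; have F1 := normal_cdf_le1 R x.
rewrite /stein_sol; case: (leP x a) => xa.
  have [xM|xM] := leP `|x| M.
    by right; apply: near => //; rewrite ?F0 // subr_ge0 w1 gerBl.
  left; have x1 : x < - 1.
    move: xM; rewrite /M; case: (ler0P x); case: (ler0P a); lra.
  have Mi := mills_left R x ltac:(lra).
  have H : - x * stein_left x <= 1 by rewrite /stein_left mulrA ler_pdivrMr // mul1r.
  have L0 : 0 <= stein_left x by rewrite /stein_left divr_ge0 // ltW.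
  have L1 : stein_left x <= 1.
    by apply: le_trans H; rewrite ler_peMl //; lra.
  have xL : 0 <= - x * stein_left x by rewrite mulr_ge0 //; lra.
  split; first by apply: small; rewrite ?subr_ge0 ?w1 ?gerBl // ger0_norm.
  rewrite mulrCA; apply: small; rewrite ?subr_ge0 ?w1 ?gerBl //.
  by rewrite -normrN -mulNr ger0_norm.
have [xM|xM] := leP `|x| M.
  by right; apply: near => //; rewrite ?subr_ge0 ?F1 ?gerBl ?w0.
left; have x1 : 1 < x.
  move: xM; rewrite /M; case: (ler0P x); case: (ler0P a); lra.
have Mi := mills_right R x ltac:(lra).
have H : x * stein_right x <= 1 by rewrite /stein_right mulrA ler_pdivrMr // mul1r.
have L0 : 0 <= stein_right x by rewrite /stein_right divr_ge0 ?subr_ge0 // ltW.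
have L1 : stein_right x <= 1.
  by apply: le_trans H; rewrite ler_peMl //; lra.
have xL : 0 <= x * stein_right x by rewrite mulr_ge0 //; lra.
split; first by apply: small; rewrite ?w0 // ger0_norm.
by rewrite mulrCA; apply: small; rewrite ?w0 // ger0_norm.
Qed.

Lemma stein_der_bound x : `|stein_der x| <= stein_const.
Proof.
have w0 : 0 <= w := normal_cdf_ge0 R a; have w1 : w <= 1 := normal_cdf_le1 R a.
have [_ H] := stein_sol_bounds x; rewrite /stein_der -addrA.
apply: le_trans (ler_normD _ _) _.
have : `|(x <= a)%R%:R - w| <= 1.
  by case: (x <= a); rewrite ler_norml; apply/andP; split; rewrite /=; lra.
by lra.
Qed.

Lemma stein_sol_bound x : `|stein_sol x| <= stein_const.
Proof. by have [H _] := stein_sol_bounds x; lra. Qed.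

Lemma stein_left_branch x y : y <= x -> x <= a ->
  `|stein_sol x - stein_sol y| <= stein_const * (x - y) /\
  `|stein_sol x - stein_sol y - (x - y) * stein_der x| <=
    stein_const * (x - y) ^+ 2 * (1 + `|x|).
Proof.
move=> yx xa; pose phi z := (1 - w) * stein_left z.
have E z : z <= a -> stein_sol z = phi z by rewrite /stein_sol => ->.
have dE z : z <= a -> stein_der z = z * phi z + (1 - w).
  by move=> za; rewrite /stein_der E // za /=; ring.
rewrite !(E y, E x, dE x) ?(le_trans yx) //.
apply: branch_estimates => // z.
  have D := is_derive_stein_left z.
  by rewrite /phi; apply: is_derive_eq; rewrite /GRing.scale /=; ring.
move=> /andP[_ zx]; have za := le_trans zx xa.
rewrite -dE // -E //; split; [exact: stein_sol_bound | exact: stein_der_bound].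
Qed.

Lemma stein_right_branch x y : y <= x -> a <= y -> a < x ->
  `|stein_sol x - stein_sol y| <= stein_const * (x - y) /\
  `|stein_sol x - stein_sol y - (x - y) * stein_der x| <=
    stein_const * (x - y) ^+ 2 * (1 + `|x|).
Proof.
move=> yx ay ax; pose phi z := w * stein_right z.
(* The branches agree at [a], so the right formula is valid there too. *)
have E z : a <= z -> stein_sol z = phi z.
  rewrite le_eqVlt => /orP[/eqP <-|az]; last by rewrite /stein_sol leNgt az.
  by rewrite /stein_sol lexx /phi /stein_left /stein_right -/w; ring.
have dE z : a < z -> stein_der z = z * phi z + - w.
  by move=> az; rewrite /stein_der (E z (ltW az)) leNgt az /= addr0.
rewrite !(E y, E x, dE x) ?(ltW ax) //.
apply: branch_estimates => // z.
  have D := is_derive_stein_right z.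
  by rewrite /phi; apply: is_derive_eq; rewrite /GRing.scale /=; ring.
move=> /andP[yz _]; have az := le_trans ay yz.
(* At [z = a] the right derivative is not [stein_der a]; its bound comes from that of
   [z * stein_sol z]. *)
split; first by rewrite -E // stein_sol_bound.
have w0 : 0 <= w := normal_cdf_ge0 R a; have w1 : w <= 1 := normal_cdf_le1 R a.
have [_ H] := stein_sol_bounds z; rewrite -E //.
by apply: le_trans (ler_normB _ _) _; rewrite (ger0_norm w0); lra.
Qed.

Lemma stein_sol_lip x u : 0 <= u -> `|stein_sol x - stein_sol (x - u)| <= stein_const * u.
Proof.
move=> u0; have yx : x - u <= x by rewrite gerBl.
have U : x - (x - u) = u by ring.
have [xa|ax] := leP x a.
  by have [+ _] := stein_left_branch x (x - u) yx xa; rewrite U.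
have [ya|ay] := leP a (x - u).
  by have [+ _] := stein_right_branch x (x - u) yx ya ax; rewrite U.
have [H1 _] := stein_right_branch x a (ltW ax) (lexx a) ax.
have [H2 _] := stein_left_branch a (x - u) (ltW ay) (lexx a).
have -> : stein_sol x - stein_sol (x - u) =
  (stein_sol x - stein_sol a) + (stein_sol a - stein_sol (x - u)) by ring.
apply: le_trans (ler_normD _ _) _; lra.
Qed.

Lemma stein_sol_taylor x u : 0 <= u -> ~~ (a < x <= a + u) ->
  `|stein_sol x - stein_sol (x - u) - u * stein_der x| <=
    stein_const * u ^+ 2 * (1 + `|x|).
Proof.
move=> u0 xu; have yx : x - u <= x by rewrite gerBl.
have U : x - (x - u) = u by ring.
have [xa|ax] := leP x a.
  by have [_] := stein_left_branch x (x - u) yx xa; rewrite U.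
have ya : a <= x - u by move: xu; rewrite ax /= -ltNge => /ltW; rewrite lerBrDr.
by have [_] := stein_right_branch x (x - u) yx ya ax; rewrite U.
Qed.

End SteinSolution.

(** * Asymptotics of the dimension of a class *)

Section ClassFrequencies.
Variable R : realType.

(** Expanding a function into indicators of integers is valid only at natural arguments, which
    [eq_Ex] cannot express. *)
Lemma eq_Ex_nat N (F G : R -> R -> R) :
  (forall h s : nat, (h + s <= N)%N -> F h%:R s%:R = G h%:R s%:R) ->
  Ex R N F = Ex R N G.
Proof.
move=> FG; congr (_ / _); apply: eq_bigr => h _; apply: eq_bigr => s _.
by have [k|k] := leqP (h + s)%N N; [rewrite FG | rewrite weight_out ?mul0r].
Qed.

Lemma Ex_sum N M (F : nat -> R -> R -> R) :
  Ex R N (fun h s => \sum_(q < M) F q h s) = \sum_(q < M) Ex R N (F q).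
Proof.
elim: M => [|M IH].
  by rewrite big_ord0 -[RHS](Ex_cst R N); apply: eq_Ex_nat => h s _; rewrite big_ord0.
rewrite big_ord_recr /= -IH -ExD; apply: eq_Ex_nat => h s _.
by rewrite big_ord_recr.
Qed.

Lemma sum_comb_data_Esum N (F : R -> R -> R) :
  \sum_(D in comb_data N.+1) F (npairs D.1.1 D.1.2)%:R (npairs D.1.1 D.2)%:R =
  Esum R N F.
Proof.
rewrite (sum_comb_data _ _ (fun h s => F h%:R s%:R)) //.
apply: eq_bigr => h _; apply: eq_bigr => s _.
rewrite /weight -count_trees ratr_nat mulr_natl.
by have -> : (2 * N.+1 - 2 = 2 * N)%N by lia.
Qed.

Lemma class_freqE N q :
  class_freq R N.+1 q = Ex R N (fun h s => (h + 2 * s == q%:R)%R%:R).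
Proof.
rewrite /class_freq /Ex -!sum_comb_data_Esum; congr (_ / _).
  rewrite /nclasses_dim -sum1_card natr_sum /=.
  rewrite (eq_bigl (fun D => (D \in comb_data N.+1) && (class_dim D == q))); last first.
    by move=> D; rewrite inE.
  rewrite big_mkcondr /=; apply: eq_bigr => D _.
  rewrite -natrM -natrD eqr_nat /class_dim addnC.
  by case: eqP.
by rewrite /nclasses -sum1_card natr_sum.
Qed.

Lemma class_freq_out N q : (3 * N < q)%N -> class_freq R N.+1 q = 0.
Proof.
move=> Nq; rewrite class_freqE -[RHS](Ex_cst R N); apply: eq_Ex => h s h0 s0 hs.
case: eqP => // E; exfalso.
have : (3 * N)%:R < q%:R :> R by rewrite ltr_nat.
by rewrite -E natrM; lra.
Qed.

Lemma sum_class_freq N M (phi : R -> R) : (3 * N < M)%N ->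
  \sum_(q < M) phi q%:R * class_freq R N.+1 q = Ex R N (fun h s => phi (h + 2 * s)).
Proof.
move=> NM; under eq_bigr do rewrite class_freqE -ExZ.
rewrite -(Ex_sum N M (fun q h s => phi q%:R * (h + 2 * s == q%:R)%R%:R)).
apply: eq_Ex_nat => h s hs; have hM : (h + 2 * s < M)%N by lia.
rewrite (bigD1 (Ordinal hM)) //= natrD natrM eqxx mulr1 big1 ?addr0 // => q qh.
rewrite -natrM -natrD eqr_nat; case: eqP => [E|]; last by rewrite mulr0.
by move/eqP: qh; case; apply: val_inj.
Qed.

Lemma series_finite (u : nat -> R) M : (forall q, (M <= q)%N -> u q = 0) ->
  series u @ \oo --> \sum_(q < M) u q.
Proof.
move=> uM; apply: cvg_near_cst; exists M => // m /= Mm.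
rewrite /series /= -(big_mkord xpredT) (big_cat_nat _ Mm) //=.
rewrite [X in _ + X](_ : _ = 0) ?addr0 // big_nat_cond big1 // => q.
by move=> /andP[/andP[/uM]].
Qed.

End ClassFrequencies.

(** * Algebraic constants, linear growth, and laws carried by the integers *)

Section Limits.
Variable R : realType.

Lemma algebraicOver_sqrt5 : algebraicOver (ratr : rat -> R) (sqrt5 R).
Proof.
exists ('X^2 - 5%:P); first exact: monic_neq0 (monicXnsubC _ _).
rewrite rmorphB /= map_polyXn map_polyC /= /root !hornerE /= ratr_nat.
by rewrite expr2 sqrt5_sq subrr.
Qed.

Lemma algebraicOver_nat k : algebraicOver (ratr : rat -> R) k%:R.
Proof. by rewrite -ratr_nat; exact: algebraic_id. Qed.

Lemma asymp_equiv_linear (u : nat -> R) (k C : R) : 0 < k ->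
  (forall d, (2 <= d)%N -> `|u d - k * d%:R| <= C * Num.sqrt d%:R) ->
  asymp_equiv u (fun d => k * d%:R).
Proof.
move=> k0 H; apply/cvgrPdist_le => e e0.
near=> d.
have d2 : (2 <= d)%N by near: d; exists 2.
have d0 : 0 < d%:R :> R by rewrite ltr0n (ltn_trans _ d2).
have kd : 0 < k * d%:R by rewrite mulr_gt0.
have := H d d2.
have -> : 1 - u d / (k * d%:R) = - ((u d - k * d%:R) / (k * d%:R)).
  by field; rewrite !gt_eqF.
rewrite normrN normrM normfV (gtr0_norm kd) ler_pdivrMr // => /le_trans; apply.
have r0 : 0 < Num.sqrt d%:R :> R by rewrite sqrtr_gt0.
have rr : Num.sqrt d%:R * Num.sqrt d%:R = d%:R :> R by rewrite -expr2 sqr_sqrtr ?ler0n.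
rewrite -[X in _ <= e * (k * X)]rr !mulrA ler_pM2r //.
have large : (`|C| / (e * k)) ^+ 2 <= d%:R by near: d; exact: nbhs_infty_ger.
have : `|C| / (e * k) <= Num.sqrt d%:R.
  rewrite -[leLHS]ger0_norm; last exact: divr_ge0 (normr_ge0 _) (ltW (mulr_gt0 e0 k0)).
  by rewrite -sqrtr_sqr ler_sqrt // ler0n.
rewrite ler_pdivrMr ?mulr_gt0 // => /(le_trans (ler_norm C)).
by rewrite mulrC.
Unshelve. all: by end_near. Qed.

Lemma prob_preimage_ge (disp : measure_display) (T : measurableType disp)
    (P : probability T R) (X : {RV P >-> R}) (p : nat -> R) M (B : pred R) :
  (forall q : nat, P (X @^-1` [set q%:R]) = (p q)%:E) ->
  measurable (X @^-1` [set y | B y]) ->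
  ((\sum_(q < M | B q%:R) p q)%:E <= P (X @^-1` [set y | B y]))%E.
Proof.
move=> Pp mB.
have mX (q : nat) : measurable (X @^-1` [set q%:R]).
  by rewrite -[X in measurable X]setTI; exact: measurable_funP.
have -> : (\sum_(q < M | B q%:R) p q)%:E =
    P (\big[setU/set0]_(q < M | B q%:R) (X @^-1` [set q%:R])).
  rewrite measure_bigsetU_ord //.
    by rewrite -sumEFin; apply: eq_bigr => q _; exact/esym/Pp.
  move=> i j _ _ [w [/= -> /eqP]]; rewrite eqr_nat => /eqP E.
  exact: val_inj.
apply: le_measure; rewrite ?inE //.
  by apply: bigsetU_measurable => q _.
apply: (big_ind (fun A => A `<=` X @^-1` [set y | B y])) => //.
  by move=> A1 A2 A1B A2B w [/A1B|/A2B].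
by move=> q Bq w /= ->.
Qed.

(** [X] may take other values on a null set. The atoms bound the probabilities of the event and of
    its complement from below, and total mass [1] turns both bounds into equalities. *)
Lemma prob_preimage (disp : measure_display) (T : measurableType disp)
    (P : probability T R) (X : {RV P >-> R}) (p : nat -> R) M (B : pred R) :
  (forall q : nat, P (X @^-1` [set q%:R]) = (p q)%:E) -> \sum_(q < M) p q = 1 ->
  measurable (X @^-1` [set y | B y]) ->
  P (X @^-1` [set y | B y]) = (\sum_(q < M) (B q%:R)%:R * p q)%:E.
Proof.
move=> Pp p1 mB; have mNB : measurable (X @^-1` [set y | ~~ B y]).
  rewrite (_ : _ @^-1` _ = ~` (X @^-1` [set y | B y])); first exact: measurableC.
  by apply/seteqP; split => w /= /negP.
have -> : \sum_(q < M) (B q%:R)%:R * p q = \sum_(q < M | B q%:R) p q.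
  by rewrite [RHS]big_mkcond; apply: eq_bigr => q _; case: (B _); rewrite ?mul1r ?mul0r.
apply/eqP; rewrite eq_le (prob_preimage_ge _ _ P X p M B) // andbT.
have := prob_preimage_ge _ _ P X p M (fun y => ~~ B y) Pp mNB.
rewrite (_ : X @^-1` [set y | ~~ B y] = ~` (X @^-1` [set y | B y])); last first.
  by apply/seteqP; split => w /= /negP.
rewrite probability_setC // -(fineK (fin_num_measure P _ mB)) -EFinB !lee_fin.
have := p1; rewrite (bigID (fun q : 'I_M => B q%:R)) /=.
by move: (\sum_(_ < _ | _) _) (\sum_(_ < _ | _) _) => x y; lra.
Qed.

End Limits.

(** * Mean, variance and distribution function for large degree *)

Section Asymptotics.
Variable R : realType.

Lemma distr_mean_class_freq N : distr_mean (class_freq R N.+1) = class_mean R N.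
Proof.
apply: cvg_lim => //.
rewrite (_ : class_mean R N = \sum_(q < (3 * N).+1) mean_terms (class_freq R N.+1) q).
  apply: series_finite => q Nq; by rewrite /mean_terms class_freq_out ?mulr0.
exact/esym/(sum_class_freq R N _ id).
Qed.

Lemma distr_variance_class_freq N : distr_variance (class_freq R N.+1) = class_var R N.
Proof.
apply: cvg_lim => //.
rewrite (_ : class_var R N = \sum_(q < (3 * N).+1) variance_terms (class_freq R N.+1) q).
  apply: series_finite => q Nq; by rewrite /variance_terms class_freq_out ?mulr0.
rewrite /variance_terms distr_mean_class_freq.
exact/esym/(sum_class_freq R N _ (fun x => (x - class_mean R N) ^+ 2)).
Qed.

Lemma var_rate_bounds : 48 / 100 < var_rate R < 49 / 100.
Proof.
by have /andP[? ?] := sqrt5_bounds R; rewrite /var_rate; apply/andP; split; lra.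
Qed.

Lemma pair_rate_gt0 : 0 < pair_rate R.
Proof. by have /andP[? _] := pair_rate_bounds R; lra. Qed.

Lemma sqrt_natS_ge N : 1 <= Num.sqrt N.+1%:R :> R.
Proof. by rewrite -[leLHS]sqrtr1 ler_sqrt ?ler1n // ltr0n. Qed.

Lemma mean_asymp : asymp_equiv (fun d => distr_mean (class_freq R d))
  (fun d => 3 / 2 * pair_rate R * d%:R).
Proof.
have c0 := pair_rate_gt0.
(* The size is [d - 1], so the error [1] of [mean_le] grows by [3/2 pair_rate < 2]. *)
apply: (asymp_equiv_linear R _ _ 3); first by lra.
move=> [|[|N]] // _; rewrite distr_mean_class_freq.
have := mean_le R N.+1 isT; have := sqrt_natS_ge N.+1.
have /andP[c1 c2] := pair_rate_bounds R; rewrite -[N.+2%:R]natr1.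
move: (class_mean R N.+1) (Num.sqrt _) => m r r1; rewrite !ler_norml => /andP[? ?].
by apply/andP; split; lra.
Qed.

Lemma variance_asymp : asymp_equiv (fun d => distr_variance (class_freq R d))
  (fun d => var_rate R * d%:R).
Proof.
have /andP[l1 l2] := var_rate_bounds.
apply: (asymp_equiv_linear R _ _ 11); first by lra.
move=> [|[|N]] // _; rewrite distr_variance_class_freq.
have := var_le R N.+1 isT; have := sqrt_natS_ge N.+1.
have : sqrt_size R N.+1 <= Num.sqrt N.+2%:R by rewrite /sqrt_size ler_sqrt ?ltr0n // ler_nat.
rewrite -[in var_rate R * _]natr1.
move: (class_var R N.+1) (Num.sqrt _) (sqrt_size R N.+1) => m r t tr r1.
by rewrite !ler_norml => /andP[? ?]; apply/andP; split; lra.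
Qed.

(** From [2500 = 50^2] on, the error [10 sqrt_size] is at most [n / 5], and [0.48 - 0.2 > 1/4]. *)
Lemma var_lower N : (2500 <= N)%N -> N%:R / 4 <= class_var R N.
Proof.
move=> N2; have N0 : (0 < N)%N := leq_trans (isT : (0 < 2500)%N) N2.
have /andP[l1 _] := var_rate_bounds.
have := var_le R N N0; rewrite ler_norml => /andP[H _].
have rr := sqrt_size_sq R N; have r0 := sqrt_size_gt0 R N N0.
have r50 : 50 <= sqrt_size R N.
  rewrite -(ler_pXn2r (ltn0Sn 1)) ?nnegrE ?(ltW r0) // [leRHS]expr2 rr.
  by rewrite -natrX ler_nat.
have : sqrt_size R N * 50 <= N%:R by rewrite -rr ler_pM2l.
have : 48 / 100 * N%:R <= var_rate R * N%:R by rewrite ler_wpM2r // ltW.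
by lra.
Qed.

Lemma normal_approximation (x : R) N : (2500 <= N)%N ->
  sqrt_size R N * `|Ex R N (fun h s => (std_dim R N h s <= x)%R%:R) - normal_cdf R x| <=
    2300 * stein_const R x.
Proof.
move=> N2; have N0 : (0 < N)%N := leq_trans (isT : (0 < 2500)%N) N2.
have := stein_bound R N N0 (stein_sol R x) (stein_der R x) x (stein_const R x)
  (stein_sol_bound R x) (stein_der_bound R x) (stein_sol_lip R x)
  (stein_sol_taylor R x) (var_lower N N2).
suff -> : Ex R N (fun h s => stein_der R x (std_dim R N h s) -
    std_dim R N h s * stein_sol R x (std_dim R N h s)) =
  Ex R N (fun h s => (std_dim R N h s <= x)%R%:R) - normal_cdf R x by [].
rewrite -[normal_cdf R x](Ex_cst R N) -ExB; apply: eq_Ex => h s _ _ _.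
by rewrite /stein_der; ring.
Qed.

End Asymptotics.

Theorem theorem5p1 (R : realType) :
  (forall d : nat, (2 <= d)%N ->
     [/\ is_discrete_distr (class_freq R d),
         cvgn (series (mean_terms (class_freq R d)))
       & cvgn (series (variance_terms (class_freq R d)))])
  /\
  (exists kappa lambda : R,
     [/\ algebraicOver (ratr : rat -> R) kappa,
         algebraicOver (ratr : rat -> R) lambda,
         asymp_equiv (fun d => distr_mean (class_freq R d))
                     (fun d => kappa * d%:R)
       & asymp_equiv (fun d => distr_variance (class_freq R d))
                     (fun d => lambda * d%:R)])
  /\
  (forall (disp : nat -> measure_display)
          (Omega : forall d, measurableType (disp d))
          (P : forall d, probability (Omega d) R)
          (X : forall d, {RV (P d) >-> R}),
     (forall d q : nat, (2 <= d)%N ->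
        P d (X d @^-1` [set q%:R]) = (class_freq R d q)%:E) ->
     cvg_in_distribution P
       (fun d w => (X d w - distr_mean (class_freq R d))
                   / Num.sqrt (distr_variance (class_freq R d)))
       (normal_prob (0 : R) 1)).
Proof.
split=> [[|N] // _|].
  split.
  - split=> [q|]; first by rewrite /class_freq divr_ge0 ?ler0n.
    rewrite (_ : 1 = \sum_(q < (3 * N).+1) class_freq R N.+1 q).
      by apply: series_finite => q; exact: class_freq_out.
    have := sum_class_freq R N (3 * N).+1 (fun=> 1) (leqnn _).
    by rewrite Ex_cst => <-; apply: eq_bigr => q _; rewrite mul1r.
  - apply/cvg_ex; eexists; apply: (series_finite R _ (3 * N).+1) => q Nq.
    by rewrite /mean_terms class_freq_out ?mulr0.
  - apply/cvg_ex; eexists; apply: (series_finite R _ (3 * N).+1) => q Nq.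
    by rewrite /variance_terms class_freq_out ?mulr0.
split.
  exists (3 / 2 * pair_rate R), (var_rate R); split.
  - do ![apply: algebraic_mul | apply: algebraic_inv | apply: algebraic_sub |
      exact: algebraicOver_nat | exact: algebraicOver_sqrt5].
  - do ![apply: algebraic_sub | apply: algebraic_mul | apply: algebraic_inv |
      exact: algebraicOver_nat | exact: algebraicOver_sqrt5].
  - exact: mean_asymp.
  - exact: variance_asymp.
move=> disp Omega P X PX x _.
rewrite -(normal_cdf_fin R x).
have cdfE d : (2 <= d)%N ->
    P d [set w | (X d w - distr_mean (class_freq R d))
                   / Num.sqrt (distr_variance (class_freq R d)) <= x] =
    (Ex R d.-1 (fun h s => (std_dim R d.-1 h s <= x)%R%:R))%:E.
  case: d => [//|N] N0; rewrite distr_mean_class_freq distr_variance_class_freq /=.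
  pose B y := (y - class_mean R N) / Num.sqrt (class_var R N) <= x.
  rewrite -(sum_class_freq R N (3 * N).+1 (fun y => (B y)%:R)) //.
  apply: (prob_preimage _ _ _ (P N.+1) (X N.+1) _ _ B).
  - by move=> q; exact: PX.
  - have := sum_class_freq R N (3 * N).+1 (fun=> 1) (leqnn _).
    by rewrite Ex_cst => <-; apply: eq_bigr => q _; rewrite mul1r.
  - have mY : measurable_fun setT
        (fun w => (X N.+1 w - class_mean R N) / Num.sqrt (class_var R N)).
      by apply: measurable_funM => //; apply: measurable_funB.
    have := mY measurableT [set` `]-oo, x]] (measurable_itv _).
    by rewrite setTI (_ : _ @^-1` _ = X N.+1 @^-1` [set y | B y]) // set_itvE.
apply/fine_cvgP; split.
  by exists 2 => // d /= d2; rewrite cdfE.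
apply/cvgrPdist_le => e e0; near=> d.
have d2 : (2 <= d)%N by near: d; exists 2.
have dN : (2500 <= d.-1)%N by near: d; exists 2501 => // d /=; case: d.
have N0 : (0 < d.-1)%N := leq_trans (isT : (0 < 2500)%N) dN.
(* This makes [sqrt_size] of [d.-1] at least [2300 * stein_const R x / e]; the [+ 1] pays for the
   predecessor. *)
have large : (2300 * stein_const R x / e) ^+ 2 + 1 <= d%:R by near: d; exact: nbhs_infty_ger.
rewrite /= cdfE //= distrC.
rewrite -(ler_pM2l (sqrt_size_gt0 R d.-1 N0)).
apply: le_trans (normal_approximation R x d.-1 dN) _; rewrite -ler_pdivrMr //.
apply: le_trans (ler_norm _) _; rewrite -sqrtr_sqr /sqrt_size ler_sqrt ?ler0n //.
by rewrite -(lerD2r 1) natr1 prednK // (ltn_trans _ d2).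
Unshelve. all: by end_near.
Qed.
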